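(* $\mathbf{FPC}\subseteq\mathbf{FP}$: every function computed by a well-typed CorePolyC program is computable by a deterministic Turing machine in time polynomial in the total binary length of its input.
   Context: CorePolyC. Types are $\mathtt{iint},\mathtt{int},\mathtt{bool}$; $\mathsf{Int}=\{\mathtt{iint},\mathtt{int}\}$, ordered by $\mathtt{iint}\preccurlyeq\mathtt{int}$. Values are unbounded integers ($\mathbb Z$) and booleans $\#t,\#f$. Expressions: variables $x$; constants (nonempty decimal digit strings denoting natural numbers; $\mathtt{true}$, $\mathtt{false}$); operator applications $\mathtt{op}(e_1,\dots,e_m)$; parenthesized $(e)$. Operators and semantics: unary $-$ (negation); binary $+,-,/,\%$ (integer addition, subtraction, division, remainder, with division and remainder by $0$ returning $0$); $\mathtt{size}$, with $\mathtt{size}(v)=\lceil\log_2(\mathrm{abs}(v)+1)\rceil$; comparisons $\texttt{>=},\texttt{<=},\texttt{>},\texttt{<},\texttt{==},\texttt{!=}$ on integers returning booleans; boolean $\texttt{!},\texttt{\&\&},\texttt{||}$. Statements: declaration $t\ x;$; assignment $x=e;$; block $\{s_1\dots s_m\}$; conditional $\mathbf{if}(e)\ s_1\ \mathbf{else}\ s_2$; loop $\mathbf{for}(x<\mathtt{size}(e))\ s$ (loop bounds are always syntactically of the form $\mathtt{size}(e)$). A program is $\mathbf{int\ main}(\mathbf{int}\ x_1,\dots,\mathbf{int}\ x_m)\{s_1\dots s_k\ \mathbf{return}\ e;\}$. Semantics (big-step). A store $\Sigma$ is a finite partial map from variables to values; $\Sigma[x\mapsto v]$ is the update. $\Sigma\vdash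 e\Downarrow v$: a variable $x\in\mathrm{dom}\,\Sigma$ evaluates to $\Sigma(x)$, constants to their value, $\mathtt{op}(e_1,\dots,e_m)$ to $\mathtt{op}$ applied to the values of the $e_i$. $\Sigma\vdash s\Downarrow\Sigma'$: $t\ x;$ gives $\Sigma[x\mapsto 0]$ if $t\in\mathsf{Int}$ and $\Sigma[x\mapsto\#f]$ if $t=\mathtt{bool}$; $x=e;$ (with $x\in\mathrm{dom}\,\Sigma$) gives $\Sigma[x\mapsto v]$ where $\Sigma\vdash e\Downarrow v$; a sequence or block executes its statements in order threading the store (a block returns the final store); a conditional evaluates its guard to a boolean and executes the corresponding branch; $\mathbf{for}(x<e)\ s$ evaluates $e$ once to an integer $i$, sets $\Sigma_0=\Sigma$, executes $s$ from $\Sigma_j[x\mapsto j]$ obtaining $\Sigma_{j+1}$ for $j=0,\dots,i-1$, and ends in $\Sigma_i$ (i.e. in $\Sigma$ if $i\le 0$). A program on inputs $v_1,\dots,v_m$ runs its statements from the store $[x_1\mapsto v_1,\dots,x_m\mapsto v_m]$ and outputs the value of its return expression in the resulting store. Type system. A typing environment $\Gamma$ is a finite partial map from variables to types; $\ell\in\{\#t,\#f\}$ is the loop indicator. Expression typing $\Gamma,\ell\vdash e:t$: a variable $x\in\mathrm{dom}\,\Gamma$ has type $\Gamma(x)$; digit literals have type $\mathtt{iint}$, $\mathtt{true},\mathtt{false}$ have type $\mathtt{bool}$; $\texttt{!},\texttt{\&\&},\texttt{||}$ take $\mathtt{bool}$ arguments to $\mathtt{bool}$; comparisons take arguments with types in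 $\mathsf{Int}$ to $\mathtt{bool}$; $+,-,/,\%$ take arguments with types in $\mathsf{Int}$ to their supremum under $\preccurlyeq$ ($\mathtt{iint}$ iff all arguments are $\mathtt{iint}$); $\mathtt{size}$ takes only an $\mathtt{iint}$ argument, giving $\mathtt{iint}$; parentheses preserve types. Statement typing $\Gamma,\ell\vdash s:\Gamma'$: $t\ x;$ is typable iff $x\notin\mathrm{dom}\,\Gamma$ and not($\ell=\#t$ and $t=\mathtt{iint}$), giving $\Gamma[x\mapsto t]$; $x=e;$ is typable iff $x\in\mathrm{dom}\,\Gamma$, not($\ell=\#t$ and $\Gamma(x)=\mathtt{iint}$), and $\Gamma,\ell\vdash e:t$ with $t,\Gamma(x)$ both in $\mathsf{Int}$ or both $\mathtt{bool}$, giving $\Gamma$; a sequence $s_1\dots s_m$ threads $\Gamma_0=\Gamma$, $\Gamma_{i-1},\ell\vdash s_i:\Gamma_i$, giving $\Gamma_m$; a block $\{\tilde s\}$ is typable if its sequence is, giving $\Gamma$; a conditional needs a guard of type $\mathtt{bool}$ and both branches typable under $\Gamma,\ell$, giving $\Gamma$; $\mathbf{for}(x<e)\ s$ needs $\Gamma,\ell\vdash e:\mathtt{iint}$, $x\notin\mathrm{dom}\,\Gamma$, and $\Gamma[x\mapsto\mathtt{iint}],\#t\vdash s:\Gamma'$ for some $\Gamma'$, giving $\Gamma$. A program is well-typed if its statements are typable starting from $[x_1\mapsto\mathtt{int},\dots,x_m\mapsto\mathtt{int}]$ with $\ell=\#f$, ending in some $\Gamma'$, and its return expression has a type in $\mathsf{Int}$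 under $\Gamma',\#f$. A well-typed program $p$ with $m$ inputs computes a total function $[\![p]\!]:\mathbb Z^m\to\mathbb Z$; $\mathbf{FPC}$ is the set of all such functions. $\mathbf{FP}$ is the class of total functions $\mathbb Z^m\to\mathbb Z$ ($m\ge0$) computable by a deterministic Turing machine in time polynomial in the total binary length of the input. *)

(* Defs.v *)
From Stdlib Require Import ZArith.
From mathcomp Require Import all_boot.

Set Implicit Arguments.
Unset Strict Implicit.
Unset Printing Implicit Defensive.

Definition var := nat.

Inductive ty : Type := TIInt | TInt | TBool.

Definition ty_eqb (a b : ty) : bool :=
  match a, b with
  | TIInt, TIInt | TInt, TInt | TBool, TBool => true
  | _, _ => false
  end.

Definition isInt (t : ty) : bool := match t with TBool => false | _ => true end.

(* supremum under iint <= int (only used on Int types) *)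
Definition sup (t1 t2 : ty) : ty :=
  match t1, t2 with TIInt, TIInt => TIInt | _, _ => TInt end.

Inductive uop : Type :=
  | ONeg
  | OSize
  | ONot.

Inductive bop : Type :=
  | OAdd | OSub | ODiv | OMod
  | OGe | OLe | OGt | OLt | OEq | ONe
  | OAnd | OOr.

Inductive expr : Type :=
  | EVar (x : var)
  | ENat (n : nat)
  | EBool (b : bool)
  | EUn (o : uop) (e : expr)
  | EBin (o : bop) (e1 e2 : expr)
  | EParen (e : expr).

(* for (x < size(e)) s  is represented as  SFor x e s  : the loop bound is
   syntactically always size(e), and e is the argument of size. *)
Inductive stmt : Type :=
  | SDecl (t : ty) (x : var)
  | SAssign (x : var) (e : expr)
  | SBlock (ss : seq stmt)
  | SIf (e : expr) (s1 s2 : stmt)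
  | SFor (x : var) (e : expr) (s : stmt).

Record program : Type := Program {
  prog_params : seq var;
  prog_body : seq stmt;
  prog_ret : expr
}.

Inductive value : Type := VInt (z : Z) | VBool (b : bool).

Definition store := var -> option value.

Definition upd {A : Type} (s : var -> option A) (x : var) (v : A) : var -> option A :=
  fun y => if y == x then Some v else s y.

Definition zsize (v : Z) : Z := Z.log2_up (Z.abs v + 1).

Definition zdiv0 (a b : Z) : Z := if Z.eqb b 0 then 0%Z else Z.quot a b.
Definition zmod0 (a b : Z) : Z := if Z.eqb b 0 then 0%Z else Z.rem a b.

Definition eval_uop (o : uop) (v : value) : option value :=
  match o, v with
  | ONeg, VInt z => Some (VInt (- z)%Z)
  | OSize, VInt z => Some (VInt (zsize z))
  | ONot, VBool b => Some (VBool (~~ b))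
  | _, _ => None
  end.

Definition eval_bop (o : bop) (v1 v2 : value) : option value :=
  match o, v1, v2 with
  | OAdd, VInt a, VInt b => Some (VInt (a + b)%Z)
  | OSub, VInt a, VInt b => Some (VInt (a - b)%Z)
  | ODiv, VInt a, VInt b => Some (VInt (zdiv0 a b))
  | OMod, VInt a, VInt b => Some (VInt (zmod0 a b))
  | OGe, VInt a, VInt b => Some (VBool (Z.geb a b))
  | OLe, VInt a, VInt b => Some (VBool (Z.leb a b))
  | OGt, VInt a, VInt b => Some (VBool (Z.gtb a b))
  | OLt, VInt a, VInt b => Some (VBool (Z.ltb a b))
  | OEq, VInt a, VInt b => Some (VBool (Z.eqb a b))
  | ONe, VInt a, VInt b => Some (VBool (~~ Z.eqb a b))
  | OAnd, VBool a, VBool b => Some (VBool (a && b))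
  | OOr, VBool a, VBool b => Some (VBool (a || b))
  | _, _, _ => None
  end.

Inductive eval (S : store) : expr -> value -> Prop :=
  | ev_var x v : S x = Some v -> eval S (EVar x) v
  | ev_nat n : eval S (ENat n) (VInt (Z.of_nat n))
  | ev_bool b : eval S (EBool b) (VBool b)
  | ev_un o e v w : eval S e v -> eval_uop o v = Some w -> eval S (EUn o e) w
  | ev_bin o e1 e2 v1 v2 w :
      eval S e1 v1 -> eval S e2 v2 -> eval_bop o v1 v2 = Some w ->
      eval S (EBin o e1 e2) w
  | ev_paren e v : eval S e v -> eval S (EParen e) v.

Definition default_value (t : ty) : value :=
  match t with TBool => VBool false | _ => VInt 0%Z end.

Inductive exec : store -> stmt -> store -> Prop :=
  | ex_decl S t x : exec S (SDecl t x) (upd S x (default_value t))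
  | ex_assign S x e v w :
      S x = Some w -> eval S e v -> exec S (SAssign x e) (upd S x v)
  | ex_block S ss S' : exec_seq S ss S' -> exec S (SBlock ss) S'
  | ex_if_true S e s1 s2 S' :
      eval S e (VBool true) -> exec S s1 S' -> exec S (SIf e s1 s2) S'
  | ex_if_false S e s1 s2 S' :
      eval S e (VBool false) -> exec S s2 S' -> exec S (SIf e s1 s2) S'
  | ex_for S x e s i S' :
      eval S (EUn OSize e) (VInt i) ->
      exec_loop x s 0%Z i S S' -> exec S (SFor x e s) S'
with exec_seq : store -> seq stmt -> store -> Prop :=
  | exs_nil S : exec_seq S [::] S
  | exs_cons S s ss S1 S2 : exec S s S1 -> exec_seq S1 ss S2 -> exec_seq S (s :: ss) S2
with exec_loop : var -> stmt -> Z -> Z -> store -> store -> Prop :=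
  | exl_done x s j i S : (i <= j)%Z -> exec_loop x s j i S S
  | exl_step x s j i S S1 S' :
      (j < i)%Z -> exec (upd S x (VInt j)) s S1 ->
      exec_loop x s (j + 1)%Z i S1 S' -> exec_loop x s j i S S'.

Fixpoint init_store (xs : seq var) (vs : seq Z) : store :=
  match xs, vs with
  | x :: xs', v :: vs' => upd (init_store xs' vs') x (VInt v)
  | _, _ => fun _ => None
  end.

Definition tenv := var -> option ty.

Definition is_bool_op (o : bop) : bool :=
  match o with OAnd | OOr => true | _ => false end.
Definition is_cmp_op (o : bop) : bool :=
  match o with OGe | OLe | OGt | OLt | OEq | ONe => true | _ => false end.
Definition is_arith_op (o : bop) : bool :=
  match o with OAdd | OSub | ODiv | OMod => true | _ => false end.

Inductive has_type (G : tenv) (l : bool) : expr -> ty -> Prop :=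
  | ty_var x t : G x = Some t -> has_type G l (EVar x) t
  | ty_nat n : has_type G l (ENat n) TIInt
  | ty_bool b : has_type G l (EBool b) TBool
  | ty_not e : has_type G l e TBool -> has_type G l (EUn ONot e) TBool
  | ty_neg e t : has_type G l e t -> isInt t -> has_type G l (EUn ONeg e) t
  | ty_size e : has_type G l e TIInt -> has_type G l (EUn OSize e) TIInt
  | ty_bool_op o e1 e2 :
      is_bool_op o ->
      has_type G l e1 TBool -> has_type G l e2 TBool -> has_type G l (EBin o e1 e2) TBool
  | ty_cmp o e1 e2 t1 t2 :
      is_cmp_op o ->
      has_type G l e1 t1 -> has_type G l e2 t2 -> isInt t1 -> isInt t2 ->
      has_type G l (EBin o e1 e2) TBool
  | ty_arith o e1 e2 t1 t2 :
      is_arith_op o ->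
      has_type G l e1 t1 -> has_type G l e2 t2 -> isInt t1 -> isInt t2 ->
      has_type G l (EBin o e1 e2) (sup t1 t2)
  | ty_paren e t : has_type G l e t -> has_type G l (EParen e) t.

Definition compat (t1 t2 : ty) : bool :=
  match t1, t2 with
  | TBool, TBool => true
  | TBool, _ | _, TBool => false
  | _, _ => true
  end.

Inductive stmt_type : tenv -> bool -> stmt -> tenv -> Prop :=
  | tys_decl G l t x :
      G x = None -> ~ (l = true /\ t = TIInt) ->
      stmt_type G l (SDecl t x) (upd G x t)
  | tys_assign G l x e tx t :
      G x = Some tx -> ~ (l = true /\ tx = TIInt) ->
      has_type G l e t -> compat t tx ->
      stmt_type G l (SAssign x e) G
  | tys_block G l ss G' : seq_type G l ss G' -> stmt_type G l (SBlock ss) G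
  | tys_if G l e s1 s2 G1 G2 :
      has_type G l e TBool -> stmt_type G l s1 G1 -> stmt_type G l s2 G2 ->
      stmt_type G l (SIf e s1 s2) G
  | tys_for G l x e s G' :
      has_type G l (EUn OSize e) TIInt -> G x = None ->
      stmt_type (upd G x TIInt) true s G' ->
      stmt_type G l (SFor x e s) G
with seq_type : tenv -> bool -> seq stmt -> tenv -> Prop :=
  | tyq_nil G l : seq_type G l [::] G
  | tyq_cons G l s ss G1 G2 :
      stmt_type G l s G1 -> seq_type G1 l ss G2 -> seq_type G l (s :: ss) G2.

Fixpoint init_tenv (xs : seq var) : tenv :=
  match xs with
  | x :: xs' => upd (init_tenv xs') x TInt
  | [::] => fun _ => None
  end.

Definition well_typed (p : program) : Prop :=
  exists G' t,
    seq_type (init_tenv (prog_params p)) false (prog_body p) G' /\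
    has_type G' false (prog_ret p) t /\ isInt t.

Definition prog_outputs (p : program) (vs : seq Z) (r : Z) : Prop :=
  exists S', exec_seq (init_store (prog_params p) vs) (prog_body p) S' /\
             eval S' (prog_ret p) (VInt r).

(* FPC: functions Z^m -> Z (represented as f : seq Z -> Z, only its values on
   sequences of length m matter) computed by a well-typed CorePolyC program
   with m inputs. *)
Definition FPC (m : nat) (f : seq Z -> Z) : Prop :=
  exists p : program,
    size (prog_params p) = m /\ well_typed p /\
    forall vs : seq Z, size vs = m -> prog_outputs p vs (f vs).

Inductive isym : Type := I0 | I1 | IMinus | ISep.

Inductive move : Type := MLeft | MRight | MStay.

Record TM : Type := {
  tm_Q : finType;
  tm_G : finType;
  tm_blank : tm_G;
  tm_sym : isym -> tm_G;
  tm_sym_inj : injective tm_sym;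
  tm_sym_nblank : forall a, tm_sym a <> tm_blank;
  tm_start : tm_Q;
  tm_halt : tm_Q;
  tm_delta : tm_Q -> tm_G -> tm_Q * tm_G * move
}.

Record config (M : TM) : Type := Config {
  cf_state : tm_Q M;
  cf_tape : Z -> tm_G M;
  cf_head : Z
}.

Definition tm_step (M : TM) (c : config M) : config M :=
  if cf_state c == tm_halt M then c
  else
    let '(q', a, mv) := tm_delta (cf_state c) (cf_tape c (cf_head c)) in
    Config q'
      (fun i => if Z.eqb i (cf_head c) then a else cf_tape c i)
      (match mv with
       | MLeft => (cf_head c - 1)%Z
       | MRight => (cf_head c + 1)%Z
       | MStay => cf_head c
       end).

Definition tm_run (M : TM) (t : nat) (c : config M) : config M := ssrnat.iter t (@tm_step M) c.

Definition word_tape (M : TM) (w : seq isym) : Z -> tm_G M :=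
  fun i => if (0 <=? i)%Z && (i <? Z.of_nat (size w))%Z
           then tm_sym M (nth I0 w (Z.to_nat i)) else tm_blank M.

Definition init_config (M : TM) (w : seq isym) : config M :=
  Config (tm_start M) (word_tape M w) 0%Z.

(* binary encodings: most significant bit first, no leading zeros *)
Fixpoint pos_bits (p : positive) : seq isym :=
  match p with
  | xH => [:: I1]
  | xO p' => rcons (pos_bits p') I0
  | xI p' => rcons (pos_bits p') I1
  end.

Definition enc_Z (z : Z) : seq isym :=
  match z with
  | Z0 => [:: I0]
  | Zpos p => pos_bits p
  | Zneg p => IMinus :: pos_bits p
  end.

Fixpoint enc_tuple (vs : seq Z) : seq isym :=
  match vs with
  | [::] => [::]
  | [:: v] => enc_Z v
  | v :: vs' => enc_Z v ++ ISep :: enc_tuple vs'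
  end.

Definition tm_computes_within (M : TM) (w : seq isym) (T : nat) (out : seq isym) : Prop :=
  let c := @tm_run M T (init_config M w) in
  cf_state c = tm_halt M /\
  (forall i, i < size out -> cf_tape c (Z.of_nat i) = tm_sym M (nth I0 out i)) /\
  cf_tape c (Z.of_nat (size out)) = tm_blank M.

Definition FP (m : nat) (f : seq Z -> Z) : Prop :=
  exists (M : TM) (c k : nat),
    forall vs : seq Z, size vs = m ->
      let w := enc_tuple vs in
      tm_computes_within M w (muln c (expn (size w).+1 k)) (enc_Z (f vs)).

(* Main.v *)
(** A program is compiled to a machine with finitely many registers holding natural
    numbers, whose operations are addition, truncated subtraction, successor, doubling,
    halving and a zero test, and whose only loop runs as often as a register has bits.
    This is the shape of the loops of the language, whose bounds are bit lengths. The
    register machine runs on one tape whose cell i holds the i-th bits of all registers: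
    an operation is a sweep to the right and back, taking time linear in the length of
    the tape and lengthening it by one cell. Polynomially many operations therefore take
    polynomial time, whatever values the registers reach.

    It remains to bound the number of operations. An arithmetic operation increases the
    bit length of its operands by at most one (there is no multiplication), so the growth
    of all values is governed by the number of assignments executed. The typing rules
    freeze the iint variables inside loops, and loop bounds are iint; so the number of
    iterations of a nest of loops is polynomial in the bit lengths on entry, and so are
    the bit lengths on exit. Outside loops only a fixed number of statements is executed,
    and these polynomial bounds are composed. *)
Require Import Defs.
From Stdlib Require Import ZArith.
From mathcomp Require Import all_boot.
From Stdlib Require Import FunctionalExtensionality.
From mathcomp Require Import zify.

Set Implicit Arguments.
Unset Strict Implicit.
Unset Printing Implicit Defensive.

(** * Bit-serial register operations and register programs *)

Fixpoint bit (i n : nat) : bool := if i is i'.+1 then bit i' n./2 else odd n.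

Lemma bit_small i n : n < 2 ^ i -> bit i n = false.
Proof.
elim: i n => [|i IH] n /=; first by rewrite expn0; lia.
by rewrite expnS => h; apply: IH; lia.
Qed.

Lemma bit0n i : bit i 0 = false.
Proof. by apply: bit_small; rewrite expn_gt0. Qed.

Inductive kind := KAdd | KSub | KInc | KDbl of bool | KHalf | KTst.

Definition ksem (k : kind) (a b : nat) : nat * bool :=
  match k with
  | KAdd => (a + b, false)
  | KSub => (a - b, a < b)
  | KInc => (a.+1, false)
  | KDbl c => (c + a.*2, false)
  | KHalf => (a./2, odd a)
  | KTst => (a, a != 0)
  end.

(* Every operation is a forward pass from the least significant bit on ([fstep], which
   maps a carry and the bits of the operands to a carry and a bit of the result),
   followed by a backward pass over the result ([bstep]). The latter shifts for [KHalf],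
   and for [KSub] it erases the result of a subtraction that ended with a borrow. *)
Definition kinit (k : kind) : bool :=
  match k with KInc => true | KDbl c => c | _ => false end.

Definition fstep (k : kind) (s a b : bool) : bool * bool :=
  match k with
  | KAdd => ((a && b) || ((a || b) && s), a (+) b (+) s)
  | KSub => ((~~ a && b) || ((~~ a || b) && s), a (+) b (+) s)
  | KInc => (a && s, a (+) s)
  | KDbl _ => (a, s)
  | KHalf => (false, a)
  | KTst => (s || a, a)
  end.

Definition bstep (k : kind) (s o : bool) : bool * bool :=
  match k with
  | KHalf => (o, s)
  | KSub => (s, o && ~~ s)
  | _ => (s, o)
  end.

Fixpoint fstate (k : kind) (s : bool) (i a b : nat) : bool :=
  if i is i'.+1 then fstate k (fstep k s (odd a) (odd b)).1 i' a./2 b./2 else s.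

Definition fout (k : kind) (s : bool) (i a b : nat) : bool :=
  (fstep k (fstate k s i a b) (bit i a) (bit i b)).2.

(** The state of the backward pass once the columns from [j] on are done. For [KHalf] it is the bit
    of the column just left, which the next lower column receives; for the other kinds it is
    constantly the final flag. *)
Definition bstate (k : kind) (j a b : nat) : bool :=
  if k is KHalf then bit j a else (ksem k a b).2.

Lemma fstateS k s i a b :
  fstate k s i.+1 a b = (fstep k (fstate k s i a b) (bit i a) (bit i b)).1.
Proof. by elim: i s a b => [|i IH] s a b //=; rewrite -IH. Qed.

Lemma foutS k s i a b :
  fout k s i.+1 a b = fout k (fstep k s (odd a) (odd b)).1 i a./2 b./2.
Proof. by []. Qed.

(** Two operands below [2 ^ i] and a carry sum to less than [2 ^ i.+1], so one extra column absorbs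
    the carry. *)
Lemma fstate_add (s : bool) i a b :
  a < 2 ^ i -> b < 2 ^ i -> fstate KAdd s i.+1 a b = false.
Proof.
elim: i a b s => [|i IH] a b s; first by rewrite expn0 /=; lia.
by rewrite expnS => ha hb; rewrite [LHS]/=; apply: IH; lia.
Qed.

Lemma fout_add (s : bool) i a b : fout KAdd s i a b = bit i (a + b + s).
Proof.
elim: i a b s => [|i IH] a b s; first by rewrite /fout /=; lia.
by rewrite foutS IH /=; congr bit; lia.
Qed.

Lemma fstate_sub (s : bool) i a b :
  a < 2 ^ i -> b < 2 ^ i -> fstate KSub s i a b = (a < b + s).
Proof.
elim: i a b s => [|i IH] a b s; first by rewrite expn0 /=; lia.
by rewrite expnS => ha hb; rewrite [LHS]/= IH; lia.
Qed.

(** The hypothesis excludes a final borrow, in which case the bits would be those of a wrapped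
    difference, erased by the backward pass. *)
Lemma fout_sub (s : bool) i a b :
  b + s <= a -> fout KSub s i a b = bit i (a - b - s).
Proof.
elim: i a b s => [|i IH] a b s h; first by rewrite /fout /=; lia.
by rewrite foutS IH /=; [congr bit|]; lia.
Qed.

Lemma fstate_inc (s : bool) i a b : a < 2 ^ i -> fstate KInc s i.+1 a b = false.
Proof.
elim: i a b s => [|i IH] a b s; first by rewrite expn0 /=; lia.
by rewrite expnS => ha; rewrite [LHS]/=; apply: IH; lia.
Qed.

Lemma fout_inc (s : bool) i a b : fout KInc s i a b = bit i (a + s).
Proof.
elim: i a b s => [|i IH] a b s; first by rewrite /fout /=; lia.
by rewrite foutS IH /=; congr bit; lia.
Qed.

Lemma fout_dbl (c s : bool) i a b : fout (KDbl c) s i a b = bit i (s + a.*2).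
Proof.
elim: i a b s => [|i IH] a b s; first by rewrite /fout /=; lia.
by rewrite foutS IH /=; congr bit; lia.
Qed.

Lemma fstate_tst (s : bool) i a b :
  a < 2 ^ i -> fstate KTst s i a b = s || (a != 0).
Proof.
elim: i a b s => [|i IH] a b s; first by rewrite expn0 /=; lia.
by rewrite expnS => ha; rewrite [LHS]/= IH; lia.
Qed.

(** The carry that leaves column [L] is what the backward pass has to start with: the borrow for
    [KSub], the outcome of the test for [KTst], and zero for the others, since column [L] of the
    operands is empty. *)
Lemma pass_turn k a b L : a < 2 ^ L -> b < 2 ^ L ->
  fstate k (kinit k) L.+1 a b = bstate k L.+1 a b.
Proof.
move=> ha hb; have e : 2 ^ L.+1 = 2 * 2 ^ L by rewrite expnS.
case: k => [|||c||].
- exact: fstate_add.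
- by rewrite fstate_sub /bstate /=; lia.
- exact: fstate_inc.
- by rewrite fstateS /bstate /= bit_small.
- by rewrite fstateS /bstate /= bit_small //; lia.
- by rewrite fstate_tst /bstate /=; lia.
Qed.

Lemma pass_back k a b j :
  bstep k (bstate k j.+1 a b) (fout k (kinit k) j a b) =
  (bstate k j a b, bit j (ksem k a b).1).
Proof.
case: k => [|||c||]; rewrite /bstate /= ?andbT.
- by rewrite fout_add; congr (_, bit _ _); lia.
- case: ltnP => h; first by rewrite andbF (_ : a - b = 0) ?bit0n //; lia.
  by rewrite andbT fout_sub; [congr (_, bit _ _)|]; lia.
- by rewrite fout_inc; congr (_, bit _ _); lia.
- by rewrite fout_dbl.
- by [].
- by [].
Qed.

Lemma bstate0 k a b : bstate k 0 a b = (ksem k a b).2.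
Proof. by case: k. Qed.

Lemma ksem_lt k a b L : a < 2 ^ L -> b < 2 ^ L -> (ksem k a b).1 < 2 ^ L.+1.
Proof. by rewrite expnS; case: k => [|||c||] /=; lia. Qed.

(** * Register programs, their semantics and their cost *)

Definition regs := nat -> nat.

Definition set_reg (R : regs) (x v : nat) : regs := fun y => if y == x then v else R y.

Record op := Op { okind : kind; ox : nat; oy : nat; oz : nat }.

Definition op_run (o : op) (R : regs) : regs :=
  set_reg R (ox o) (ksem (okind o) (R (oy o)) (R (oz o))).1.
Definition op_flag (o : op) (R : regs) : bool :=
  (ksem (okind o) (R (oy o)) (R (oz o))).2.

(* [PLoop y p] is [while (y != 0) { y := y / 2; p }]; it is only meant for
   programs [p] that do not write [y], see [wf]. *)
Inductive prog :=
  | PSkip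
  | POp of op
  | PSeq of prog & prog
  | PIf of op & prog & prog
  | PLoop of nat & prog.

(** The bit length, which is also the number of halvings that take [n] to zero; [zsize_nbits]
    identifies it with [size] of the language. *)
Definition nbits (n : nat) : nat := up_log 2 n.+1.

Lemma nbits_gt0 n : n != 0 -> nbits n = (nbits n./2).+1.
Proof. by case: n => // n _; rewrite /nbits up_log2S. Qed.

Lemma nbits_le n k : (nbits n <= k) = (n < 2 ^ k).
Proof.
apply/idP/idP => [h|]; last exact: up_log_min.
by apply: leq_trans (@up_logP 2 n.+1 isT) _; rewrite leq_exp2l.
Qed.

Fixpoint loop (p : regs -> regs) (y n : nat) (R : regs) : regs :=
  if n is n'.+1 then loop p y n' (p (set_reg R y (R y)./2)) else R.

(** Besides the body, a round costs a test, a halving and a jump back; the final 1 is the failing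
    test. *)
Fixpoint loop_cost (p : regs -> regs) (c : regs -> nat) (y n : nat) (R : regs) : nat :=
  if n is n'.+1 then
    3 + c (set_reg R y (R y)./2) + loop_cost p c y n' (p (set_reg R y (R y)./2))
  else 1.

Fixpoint run (p : prog) (R : regs) : regs :=
  match p with
  | PSkip => R
  | POp o => op_run o R
  | PSeq p q => run q (run p R)
  | PIf o p q => if op_flag o R then run p (op_run o R) else run q (op_run o R)
  | PLoop y p => loop (run p) y (nbits (R y)) R
  end.

Fixpoint cost (p : prog) (R : regs) : nat :=
  match p with
  | PSkip => 0
  | POp o => 1
  | PSeq p q => cost p R + cost q (run p R)
  | PIf o p q =>
      if op_flag o R then 2 + cost p (op_run o R) else 1 + cost q (op_run o R)
  | PLoop y p => loop_cost (run p) (cost p) y (nbits (R y)) R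
  end.

Fixpoint writes (p : prog) (r : nat) : bool :=
  match p with
  | PSkip => false
  | POp o => r == ox o
  | PSeq p q => writes p r || writes q r
  | PIf o p q => [|| r == ox o, writes p r | writes q r]
  | PLoop y p => (r == y) || writes p r
  end.

Fixpoint wf (p : prog) : bool :=
  match p with
  | PSkip | POp _ => true
  | PSeq p q | PIf _ p q => wf p && wf q
  | PLoop y p => ~~ writes p y && wf p
  end.

Lemma set_reg_id R x : set_reg R x (R x) = R.
Proof. by apply: functional_extensionality => y; rewrite /set_reg; case: eqP => // ->. Qed.

Lemma frame p R r : ~~ writes p r -> run p R r = R r.
Proof.
elim: p R => [|o|p IHp q IHq|o p IHp q IHq|y p IHp] R //=.
- by rewrite /op_run /set_reg => /negbTE->.
- by rewrite negb_or => /andP[hp hq]; rewrite IHq ?IHp.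
- rewrite !negb_or => /and3P[/negbTE h hp hq].
  by case: ifP => _; rewrite ?IHp ?IHq // /op_run /set_reg h.
- rewrite negb_or => /andP[/negbTE h hp].
  by move: (nbits (R y)) => n; elim: n R => //= n IH R; rewrite IH IHp // /set_reg h.
Qed.

(** * Compilation to flat code with jumps *)

Definition node : Type := (op * nat * nat)%type.

(** It writes register 0 back to itself; with two equal successor addresses it serves as an
    unconditional jump. *)
Definition nop : op := Op KTst 0 0 0.

Lemma op_run_tst R y z : op_run (Op KTst y y z) R = R.
Proof. exact: set_reg_id. Qed.

Fixpoint code_size (p : prog) : nat :=
  match p with
  | PSkip => 0
  | POp _ => 1
  | PSeq p q => code_size p + code_size q
  | PIf _ p q => code_size p + code_size q + 2
  | PLoop _ p => code_size p + 3
  end.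

Fixpoint compile (p : prog) (a : nat) : seq node :=
  match p with
  | PSkip => [::]
  | POp o => [:: (o, a.+1, a.+1)]
  | PSeq p q => compile p a ++ compile q (a + code_size p)
  | PIf o p q =>
      (o, a.+1, a + code_size p + 2)
      :: compile p a.+1
      ++ (nop, a + code_size p + code_size q + 2, a + code_size p + code_size q + 2)
      :: compile q (a + code_size p + 2)
  | PLoop y p =>
      [:: (Op KTst y y 0, a.+1, a + code_size p + 3); (Op KHalf y y 0, a.+2, a.+2)]
      ++ compile p a.+2 ++ [:: (nop, a, a)]
  end.

Lemma size_compile p a : size (compile p a) = code_size p.
Proof.
elim: p a => [|o|p IHp q IHq|o p IHp q IHq|y p IHp] a //=;
  by rewrite ?size_cat /= ?IHp ?IHq; lia.
Qed.

Definition node0 : node := (nop, 0, 0).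

Definition cstep (C : seq node) (c : nat * regs) : nat * regs :=
  if c.1 < size C then
    let nd := nth node0 C c.1 in
    (if op_flag nd.1.1 c.2 then nd.1.2 else nd.2, op_run nd.1.1 c.2)
  else c.

Definition code_at (C : seq node) (a : nat) (D : seq node) : Prop :=
  forall i, i < size D -> a + i < size C /\ nth node0 C (a + i) = nth node0 D i.

Lemma code_at_cat C a D1 D2 :
  code_at C a (D1 ++ D2) -> code_at C a D1 /\ code_at C (a + size D1) D2.
Proof.
move=> h; split=> i hi.
  by have := h i; rewrite size_cat nth_cat hi; apply; lia.
have := h (size D1 + i); rewrite size_cat ltn_add2l hi nth_cat addnA addKn.
by rewrite (_ : size D1 + i < size D1 = false); [apply | lia].
Qed.

Lemma code_at_cons C a x D :
  code_at C a (x :: D) -> (a < size C /\ nth node0 C a = x) /\ code_at C a.+1 D.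
Proof.
rewrite -cat1s => /code_at_cat[h1 h2]; split; last by rewrite -addn1.
by have := h1 0 isT; rewrite addn0.
Qed.

Lemma cstep_at C a o t f R : a < size C /\ nth node0 C a = (o, t, f) ->
  cstep C (a, R) = (if op_flag o R then t else f, op_run o R).
Proof. by rewrite /cstep /= => -[-> ->]. Qed.

(** The compiled loop tests its register, whereas [run] fixes the number of rounds on entry. The two
    agree because [wf] keeps the body from writing the loop register, which therefore only changes
    by halving. *)
Lemma compile_correct C p a R : wf p -> code_at C a (compile p a) ->
  iter (cost p R) (cstep C) (a, R) = (a + code_size p, run p R).
Proof.
elim: p a R => [|o|p IHp q IHq|o p IHp q IHq|y p IHp] a R /=.
- by rewrite addn0.
- by move=> _ /code_at_cons[/cstep_at-> _]; rewrite addn1; case: ifP.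
- case/andP=> wp wq /code_at_cat[hp]; rewrite size_compile => hq.
  by rewrite addnC iterD IHp // IHq // addnA.
- case/andP=> wp wq /code_at_cons[h1 /code_at_cat[hp]].
  rewrite size_compile => /code_at_cons[h2 hq].
  have E : (a.+1 + code_size p).+1 = a + code_size p + 2 by lia.
  rewrite E in hq.
  case: ifP => hf.
    rewrite add2n iterSr (cstep_at _ h1) hf iterS IHp //.
    rewrite (cstep_at _ h2) op_run_tst if_same; congr pair; lia.
  rewrite add1n iterSr (cstep_at _ h1) hf IHq //; congr pair; lia.
- case/andP=> wy wp /code_at_cons[h1 /code_at_cons[h2 /code_at_cat[hp]]].
  rewrite size_compile => /code_at_cons[h3 _].
  have [n] := ubnP (nbits (R y)); elim: n R => // n IH R hn.
  case: (posnP (R y)) => [y0|ypos].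
    have -> : nbits (R y) = 0 by apply/eqP; rewrite -leqn0 nbits_le y0.
    by rewrite [iter _ _ _]/= (cstep_at _ h1) op_run_tst /op_flag /= y0 /= addnA.
  rewrite nbits_gt0; last by rewrite -lt0n.
  rewrite [loop_cost _ _ _ _ _]/= [loop _ _ _ _]/=.
  set R1 := set_reg R y (R y)./2.
  have Ry : run p R1 y = (R y)./2 by rewrite frame // /R1 /set_reg eqxx.
  (* The first round is put innermost in the iteration: test, halving, body, jump back. *)
  have -> : 3 + cost p R1 + loop_cost (run p) (cost p) y (nbits (R y)./2) (run p R1)
    = loop_cost (run p) (cost p) y (nbits (R y)./2) (run p R1) + (cost p R1).+3 by lia.
  rewrite iterD 2!iterSr iterS (cstep_at _ h1) op_run_tst /op_flag /= -lt0n ypos.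
  rewrite (cstep_at _ h2) /op_flag /op_run /= if_same -/R1 IHp //.
  rewrite (cstep_at _ h3) op_run_tst if_same -Ry IH // Ry.
  by move: hn; rewrite nbits_gt0 // -lt0n.
Qed.

(** * The Turing machine of a register program *)

(* Track 0 marks the cells of a word; tracks 1 and 2 tell the four symbols apart. *)
Definition symbit (r : nat) (a : isym) : bool :=
  match r, a with
  | 0, _ | 1, I1 | 1, ISep | 2, IMinus | 2, ISep => true
  | _, _ => false
  end.

Fixpoint val_bits (s : seq bool) : nat := if s is b :: s' then b + (val_bits s').*2 else 0.

(** The first symbol sits in the least significant bits, so halving registers 0 to 2 removes it and
    doubling them prepends a symbol. *)
Definition inregs (w : seq isym) : regs := fun r => val_bits (map (symbit r) w).

Lemma bit_val_bits s i : bit i (val_bits s) = nth false s i.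
Proof.
elim: s i => [|b s IH] [|i] //=; rewrite ?bit0n //; first by lia.
by rewrite -IH; congr bit; lia.
Qed.

Lemma val_bits_lt s : val_bits s < 2 ^ size s.
Proof. by elim: s => //= b s IH; rewrite expnS; lia. Qed.

Lemma bit_inregs w r i : bit i (inregs w r) = (i < size w) && symbit r (nth I0 w i).
Proof.
rewrite bit_val_bits; case: ltnP => h; first by rewrite (nth_map I0).
by rewrite nth_default // size_map.
Qed.

Section Machine.
Variables (C : seq node) (k : nat).
Local Notation col := {ffun 'I_k.+3 -> bool}.

Definition bget (g : option col) (r : nat) : bool := if g is Some c then c (inord r) else false.

Definition bput (g : option col) (x : nat) (b : bool) : col :=
  [ffun i : 'I_k.+3 => if i == x :> nat then b else bget g i].

Definition mask (g : option col) : col := [ffun i : 'I_k.+3 => (i < 3) && bget g i].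

Definition symcol (a : isym) : option col := Some [ffun i : 'I_k.+3 => symbit i a].

Lemma symcol_inj : injective symcol.
Proof.
move=> a b [/ffunP h].
have h1 := h (inord 1); have h2 := h (inord 2); rewrite !ffunE !inordK // in h1 h2.
by case: a b h1 h2 {h} => [] [].
Qed.

Lemma symcol_nblank a : symcol a <> None.
Proof. by []. Qed.

(** [None] is the halting state; the extra address [size C] is the exit of the code. *)
Definition mstate : Type := option ('I_(size C).+1 * bool * bool).

Definition enter (n : nat) : mstate :=
  Some (inord n, true, kinit (okind (nth node0 C n).1.1)).

(* States are address, direction and carry. A forward pass ends by turning the first
   blank cell into a new column of zeros, so that a carry always fits. *)
Definition mdelta (q : mstate) (g : option col) : mstate * option col * move :=
  if q is Some (pc, fw, s) then
    if pc == size C :> nat then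
      if bget g 0 then (q, Some (mask g), MRight) else (None, None, MStay)
    else
      let '(o, t, f) := nth node0 C pc in
      if fw then
        let u := fstep (okind o) s (bget g (oy o)) (bget g (oz o)) in
        (Some (pc, isSome g, u.1), Some (bput g (ox o) u.2),
         if g then MRight else MStay)
      else if g then
        let u := bstep (okind o) s (bget g (ox o)) in
        (Some (pc, false, u.1), Some (bput g (ox o) u.2), MLeft)
      else (enter (if s then t else f), None, MRight)
  else (None, g, MStay).

Definition machine : TM :=
  @Build_TM mstate (option col) None symcol symcol_inj symcol_nblank (enter 0) None mdelta.

Definition mtape (L : nat) (M : nat -> nat -> bool) : Z -> option col :=
  fun z => if (0 <=? z)%Z && (z <? Z.of_nat L)%Z
           then Some [ffun r : 'I_k.+3 => M (Z.to_nat z) r] else None.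

Definition conf (q : mstate) L M (h : Z) : config machine := @Config machine q (mtape L M) h.

Lemma mtape_ext L M M' : (forall i r, i < L -> M i r = M' i r) -> mtape L M = mtape L M'.
Proof.
move=> h; apply: functional_extensionality => z; rewrite /mtape.
case: ifP => // hz; congr Some; apply/ffunP => r; rewrite !ffunE h //; lia.
Qed.

Lemma bget_mtape L M j r : r < k.+3 -> (L <= j -> M j r = false) ->
  bget (mtape L M (Z.of_nat j)) r = M j r.
Proof.
move=> hr h; rewrite /mtape; case: ifP => hj /=; last by rewrite h //; clear -hj; lia.
by rewrite ffunE Nat2Z.id inordK.
Qed.

Lemma mtape_isSome L M j : isSome (mtape L M (Z.of_nat j)) = (j < L).
Proof. by rewrite /mtape; case: ifP => /=; lia. Qed.

Definition moved (mv : move) (h : Z) : Z :=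
  match mv with MLeft => h - 1 | MRight => h + 1 | MStay => h end.

(** Writing on the first blank cell turns it into a column that is zero off track [x]; hence the
    condition on [M] when [j = L], and the new length [maxn L j.+1]. *)
Lemma step_put L M j q q' x b mv :
  mdelta (Some q) (mtape L M (Z.of_nat j)) =
    (q', Some (bput (mtape L M (Z.of_nat j)) x b), mv) ->
  j <= L -> (j = L -> forall r, M j r = false) ->
  tm_step (conf (Some q) L M (Z.of_nat j)) =
  conf q' (maxn L j.+1) (fun i r => if (i == j) && (r == x) then b else M i r)
    (moved mv (Z.of_nat j)).
Proof.
move=> hd hj hL; rewrite /tm_step [_ == _]/= [tm_delta _ _]hd /=.
congr Config; apply: functional_extensionality => z; rewrite [RHS]/mtape.
have hb (r : 'I_k.+3) : bget (mtape L M (Z.of_nat j)) r = M j r.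
  by apply: bget_mtape => // h; apply: hL; clear -h hj; lia.
case: Z.eqb_spec => [->|hz].
  rewrite ifT; last by clear -hj; lia.
  by congr Some; apply/ffunP => r; rewrite !ffunE hb Nat2Z.id eqxx.
rewrite /mtape; case: ifP => h1.
  rewrite ifT; last by clear -h1; lia.
  by congr Some; apply/ffunP => r; rewrite !ffunE (_ : Z.to_nat z == j = false) //; clear -h1 hz; lia.
by rewrite ifF //; clear -h1 hz hj; lia.
Qed.

Section Instruction.
Variables (pc : nat) (o : op) (t f : nat) (R : regs) (L : nat).
Hypotheses (hpc : pc < size C) (hnode : nth node0 C pc = (o, t, f)).
Hypotheses (hx : ox o < k.+3) (hy : oy o < k.+3) (hz : oz o < k.+3).
Hypothesis hR : forall r, R r < 2 ^ L.

Local Notation x := (ox o).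
Local Notation K := (okind o).
Local Notation a := (R (oy o)).
Local Notation b := (R (oz o)).

Let pco : 'I_(size C).+1 := inord pc.
(** [fM i] is the tape content when the forward pass has done the columns below [i]. [bM i] is the
    content when the backward pass has done those from [i] on, while the lower ones still hold the
    forward output. *)
Let fM (i : nat) : nat -> nat -> bool :=
  fun j r => if (r == x) && (j < i) then fout K (kinit K) j a b else bit j (R r).
Let bM (i : nat) : nat -> nat -> bool :=
  fun j r => if r == x then (if j < i then fout K (kinit K) j a b else bit j (ksem K a b).1)
             else bit j (R r).

Lemma delta_fw s g :
  mdelta (Some (pco, true, s)) g =
  let u := fstep K s (bget g (oy o)) (bget g (oz o)) in
  (Some (pco, isSome g, u.1), Some (bput g x u.2), if g then MRight else MStay).
Proof.
have e : pco = pc :> nat by rewrite inordK // ltnS ltnW.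
by rewrite /mdelta e (ltn_eqF hpc) hnode.
Qed.

Lemma delta_bw s g :
  mdelta (Some (pco, false, s)) g =
  if g then
    (Some (pco, false, (bstep K s (bget g x)).1),
     Some (bput g x (bstep K s (bget g x)).2), MLeft)
  else (enter (if s then t else f), None, MRight).
Proof.
have e : pco = pc :> nat by rewrite inordK // ltnS ltnW.
by rewrite /mdelta e (ltn_eqF hpc) hnode.
Qed.

Lemma fM_get i r : r < k.+3 -> i <= L -> bget (mtape L (fM i) (Z.of_nat i)) r = bit i (R r).
Proof.
move=> hr hi; have h0 r' : fM i i r' = bit i (R r') by rewrite /fM ltnn andbF.
rewrite bget_mtape ?h0 // => hL.
by rewrite bit_small // (_ : i = L) //; lia.
Qed.

(** At [i = L] the head meets the blank cell, makes it a column, turns around and stays, so that the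
    backward pass begins on that column. *)
Lemma forward_step i : i <= L ->
  tm_step (conf (Some (pco, true, fstate K (kinit K) i a b)) L (fM i) (Z.of_nat i)) =
  conf (Some (pco, i < L, fstate K (kinit K) i.+1 a b)) (maxn L i.+1) (fM i.+1)
    (if i < L then Z.of_nat i.+1 else Z.of_nat i).
Proof.
move=> hi; rewrite (step_put (delta_fw _ _)) // ?fM_get //.
  rewrite -fstateS -/(fout K (kinit K) i a b) mtape_isSome; congr Config.
    apply: mtape_ext => j r hj; rewrite /fM ltnS.
    by case: (ltngtP j i) => [h|h|->]; rewrite ?andbT ?andbF //=; case: eqP => // ->.
  by case: ltnP => h /=; lia.
by move=> -> r; rewrite /fM ltnn andbF bit_small.
Qed.

Lemma forward i : i <= L ->
  ssrnat.iter i (@tm_step machine) (conf (Some (pco, true, kinit K)) L (fM 0) 0) =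
  conf (Some (pco, true, fstate K (kinit K) i a b)) L (fM i) (Z.of_nat i).
Proof.
elim: i => [//|i IH] hi; rewrite iterS (IH (ltnW hi)) (forward_step (ltnW hi)).
by rewrite hi (_ : maxn L i.+1 = L) //; lia.
Qed.

Lemma backward i : i <= L.+1 ->
  ssrnat.iter i (@tm_step machine)
    (conf (Some (pco, false, bstate K L.+1 a b)) L.+1 (bM L.+1) (Z.of_nat L)) =
  conf (Some (pco, false, bstate K (L.+1 - i) a b)) L.+1 (bM (L.+1 - i))
    (Z.of_nat L - Z.of_nat i).
Proof.
elim: i => [|i IH] hi; first by rewrite subn0 Z.sub_0_r.
rewrite iterS (IH (ltnW hi)); have [j hj] : exists j, L.+1 - i = j.+1 by exists (L - i); lia.
have -> : L.+1 - i.+1 = j by lia.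
have -> : (Z.of_nat L - Z.of_nat i)%Z = Z.of_nat j by lia.
have -> : (Z.of_nat L - Z.of_nat i.+1)%Z = (Z.of_nat j - 1)%Z by lia.
rewrite hj.
have hb : bget (mtape L.+1 (bM j.+1) (Z.of_nat j)) x = fout K (kinit K) j a b.
  by rewrite bget_mtape ?/bM ?eqxx ?ltnSn //; lia.
have hs : isSome (mtape L.+1 (bM j.+1) (Z.of_nat j)) by rewrite mtape_isSome; lia.
have := delta_bw (bstate K j.+1 a b) (mtape L.+1 (bM j.+1) (Z.of_nat j)).
rewrite hs hb pass_back => hd; rewrite (step_put hd); [|lia|lia].
rewrite (_ : maxn L.+1 j.+1 = L.+1); last by lia.
congr Config; apply: mtape_ext => i' r hi'; rewrite /bM.
case: (eqVneq r x) => _; last by rewrite andbF.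
by rewrite andbT ltnS; case: (ltngtP i' j) => // ->.
Qed.

(** The time is [L.+1] steps forward, [L.+1] backward, and one on the blank cell [-1], where the
    flag selects the next address and the head returns to cell 0. *)
Lemma instruction :
  ssrnat.iter (L.*2 + 3) (@tm_step machine) (conf (enter pc) L (fun j r => bit j (R r)) 0) =
  conf (enter (if op_flag o R then t else f)) L.+1 (fun j r => bit j (op_run o R r)) 0.
Proof.
have hf : ssrnat.iter L.+1 (@tm_step machine) (conf (enter pc) L (fun j r => bit j (R r)) 0) =
    conf (Some (pco, false, bstate K L.+1 a b)) L.+1 (bM L.+1) (Z.of_nat L).
  have -> : conf (enter pc) L (fun j r => bit j (R r)) 0 =
            conf (Some (pco, true, kinit K)) L (fM 0) 0.
    rewrite /enter hnode; congr Config; apply: mtape_ext => j r _.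
    by rewrite /fM ltn0 andbF.
  rewrite iterS (forward (leqnn L)) (forward_step (leqnn L)) ltnn pass_turn //.
  rewrite (_ : maxn L L.+1 = L.+1); last by lia.
  congr Config; apply: mtape_ext => j r hj; rewrite /fM /bM hj andbT.
  by case: eqP.
have -> : L.*2 + 3 = (L.+1 + L.+1).+1 by lia.
rewrite iterS iterD hf (backward (leqnn L.+1)) subnn.
have -> : (Z.of_nat L - Z.of_nat L.+1)%Z = (-1)%Z by lia.
rewrite /tm_step [_ == _]/= [tm_delta _ _]delta_bw /= bstate0 -/(op_flag o R).
congr Config; apply: functional_extensionality => z.
(* The cell under the head is cell [-1], on which a blank replaces a blank. *)
case: Z.eqb_spec => [->//|_].
congr (_ z); apply: mtape_ext => j r _; rewrite /bM /op_run /set_reg; by case: ifP.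
Qed.

End Instruction.

(* The machine leaves the code at address [size C] for a last pass, which keeps
   only the tracks 0-2 of the output and blanks the cell after it. *)
Lemma final_pass L R out : (forall r, R r < 2 ^ L) ->
  (forall r, r < 3 -> R r = inregs out r) ->
  let c := ssrnat.iter (size out).+1 (@tm_step machine)
             (conf (enter (size C)) L (fun j r => bit j (R r)) 0) in
  [/\ cf_state c = None,
      forall i, i < size out -> cf_tape c (Z.of_nat i) = symcol (nth I0 out i) &
      cf_tape c (Z.of_nat (size out)) = None].
Proof.
move=> hR hout.
have hget i r : r < k.+3 -> bget (mtape L (fun j r => bit j (R r)) (Z.of_nat i)) r = bit i (R r).
  move=> hr; rewrite bget_mtape // => hi; apply: bit_small.
  by apply: leq_trans (hR r) _; rewrite leq_exp2l.
have hV i : bit i (R 0) = (i < size out).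
  by rewrite hout // bit_inregs /= andbT.
pose q : mstate := enter (size C).
have hq g : mdelta q g =
    if bget g 0 then (q, Some (mask g), MRight) else (None, None, MStay).
  by rewrite /mdelta /q /enter inordK // eqxx.
(* The pass has rewritten the cells below [i] as symbols and has not touched the others. *)
have H i : i <= size out -> exists tp,
    [/\ ssrnat.iter i (@tm_step machine) (conf q L (fun j r => bit j (R r)) 0) =
        @Config machine q tp (Z.of_nat i),
      (forall j, j < i -> tp (Z.of_nat j) = symcol (nth I0 out j)) &
      (forall j, i <= j -> tp (Z.of_nat j) = mtape L (fun j r => bit j (R r)) (Z.of_nat j))].
  elim: i => [|i IH] hi; first by exists (mtape L (fun j r => bit j (R r))).
  have [tp [e h1 h2]] := IH (ltnW hi).
  rewrite iterS e /tm_step [_ == _]/= [tm_delta _ _]hq /= h2 // hget // hV hi.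
  exists (fun z => if Z.eqb z (Z.of_nat i)
          then Some (mask (mtape L (fun j r => bit j (R r)) (Z.of_nat i))) else tp z).
  split.
  - by congr Config => /=; lia.
  - move=> j hj; case: Z.eqb_spec => hij; last by apply: h1; lia.
    have -> : j = i by lia.
    congr Some; apply/ffunP => r; rewrite !ffunE hget //.
    case: (ltnP r 3) => hr; first by rewrite hout // bit_inregs hi.
    by case: (nat_of_ord r) hr => [|[|[]]].
  - by move=> j hj; case: Z.eqb_spec => hij; [lia | apply: h2; lia].
have [tp [e h1 h2]] := H _ (leqnn _).
rewrite iterS e /tm_step [_ == _]/= [tm_delta _ _]hq /= h2 // hget // hV ltnn /=; split=> //.
  by move=> i hi; case: Z.eqb_spec => hij; [lia | apply: h1].
by rewrite Z.eqb_refl.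
Qed.

Definition node_ok (n : node) : bool :=
  let '(o, t, f) := n in
  [&& ox o < k.+3, oy o < k.+3, oz o < k.+3, t <= size C & f <= size C].

Hypothesis code_ok : all node_ok C.

(** Each instruction adds one column, so [n] bounds the tape length throughout and [n.*2 + 3] the
    time of each instruction. [T] is only bounded because [cstep] idles at the exit, where the
    machine is given no step. *)
Lemma run_code N pc R L n :
  (forall r, R r < 2 ^ L) -> L + N <= n ->
  exists T L', [/\ T <= N * (n.*2 + 3), L' <= n,
   (forall r, (ssrnat.iter N (cstep C) (pc, R)).2 r < 2 ^ L') &
   ssrnat.iter T (@tm_step machine) (conf (enter pc) L (fun j r => bit j (R r)) 0) =
   let c := ssrnat.iter N (cstep C) (pc, R) in
   conf (enter c.1) L' (fun j r => bit j (c.2 r)) 0].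
Proof.
elim: N pc R L => [|N IH] pc R L hR hn.
  by exists 0, L; rewrite -[L in L <= n]addn0.
rewrite iterSr; case: (ltnP pc (size C)) => hpc; last first.
  have -> : cstep C (pc, R) = (pc, R) by rewrite /cstep /= ltnNge hpc.
  have [|T [L' [hT hL hb e]]] := IH pc R L hR; first by lia.
  by exists T, L'; split=> //; apply: leq_trans hT _; rewrite mulSn leq_addl.
have := all_nthP node0 code_ok pc hpc; case E: (nth node0 C pc) => [[o t] f].
case/and5P=> hx hy hz ht hf.
rewrite (cstep_at _ (conj hpc E)).
have hR' : forall r, op_run o R r < 2 ^ L.+1.
  move=> r; rewrite /op_run /set_reg; case: ifP => _; first exact: ksem_lt.
  by apply: leq_trans (hR r) _; rewrite leq_exp2l.
have [|T [L' [hT hL hb e]]] := IH (if op_flag o R then t else f) _ L.+1 hR'; first by lia.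
exists (T + (L.*2 + 3)), L'; split=> //.
  by rewrite mulSn addnC leq_add //; lia.
by rewrite iterD (instruction hpc E).
Qed.

End Machine.

Lemma init_tape C k w :
  init_config (machine C k) w = conf k (enter C 0) (size w) (fun j r => bit j (inregs w r)) 0.
Proof.
congr Config; apply: functional_extensionality => z; rewrite /word_tape /mtape.
case: ifP => // hz; congr Some; apply/ffunP => r.
by rewrite !ffunE bit_inregs (_ : Z.to_nat z < size w) //; lia.
Qed.

Lemma run_halted M n c : cf_state c = tm_halt M -> tm_run n c = c.
Proof. by move=> h; elim: n => //= n ->; rewrite /tm_step h eqxx. Qed.

Fixpoint top_reg (p : prog) : nat :=
  match p with
  | PSkip => 0
  | POp o => maxn (ox o) (maxn (oy o) (oz o))
  | PSeq p q => maxn (top_reg p) (top_reg q)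
  | PIf o p q =>
      maxn (maxn (ox o) (maxn (oy o) (oz o))) (maxn (top_reg p) (top_reg q))
  | PLoop y p => maxn y (top_reg p)
  end.

Definition in_range (k n : nat) (nd : node) : bool :=
  let '(o, t, f) := nd in
  [&& ox o < k.+3, oy o < k.+3, oz o < k.+3, t <= n & f <= n].

Lemma compile_in_range k n p a :
  top_reg p <= k -> a + code_size p <= n -> all (in_range k n) (compile p a).
Proof.
elim: p a => [|o|p IHp q IHq|o p IHp q IHq|y p IHp] a //=.
- by move=> h1 h2; rewrite andbT; lia.
- by move=> h1 h2; rewrite all_cat IHp ?IHq //; lia.
- by move=> h1 h2; rewrite all_cat /= IHp ?IHq //=; lia.
- by move=> h1 h2; rewrite all_cat /= IHp //=; lia.
Qed.

(** The bound on [T] adds up the instructions, each on a tape of at most [size w + cost] columns,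
    and the final pass. *)
Lemma machine_of_prog (p : prog) : wf p ->
  exists M : TM, forall w out T,
  (forall r, r < 3 -> run p (inregs w) r = inregs out r) ->
  cost p (inregs w) * ((size w + cost p (inregs w)).*2 + 3)
    + (size w + cost p (inregs w)).+1 <= T ->
  tm_computes_within M w T out.
Proof.
move=> hwf; exists (machine (compile p 0) (top_reg p)) => w out T hout hT.
set n := size w + _ in hT.
have hok : all (node_ok (compile p 0) (top_reg p)) (compile p 0).
  by apply: compile_in_range; rewrite ?size_compile.
have hcode : code_at (compile p 0) 0 (compile p 0) by [].
have := compile_correct (inregs w) hwf hcode; rewrite add0n => E.
have hlt r : inregs w r < 2 ^ size w.
  by rewrite -(size_map (symbit r)); apply: val_bits_lt.
have [T1 [L [hT1 hL]]] := run_code hok 0 hlt (leqnn n).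
rewrite E /= -{1}(size_compile p 0) => hb e1.
(* Track 0 of the output is set in every cell of the word, while the register holding it is below
   [2 ^ n]. *)
have hsz : size out <= n.
  rewrite leqNgt; apply/negP => h.
  have : bit n (run p (inregs w) 0) = true by rewrite hout // bit_inregs h.
  by rewrite bit_small // (leq_trans (hb 0)) // leq_exp2l.
have [h1 h2 h3] := @final_pass (compile p 0) (top_reg p) L _ out hb hout.
rewrite /tm_computes_within.
have -> : tm_run T (init_config (machine (compile p 0) (top_reg p)) w) =
  ssrnat.iter (size out).+1 (@tm_step _)
    (conf (top_reg p) (enter (compile p 0) (size (compile p 0))) L (fun j r => bit j (run p (inregs w) r)) 0).
  (* The surplus steps are spent in the halting state. *)
  have -> : T = (T - (T1 + (size out).+1)) + ((size out).+1 + T1) by lia.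
  by rewrite /tm_run !iterD init_tape e1 -/(tm_run _ _) run_halted.
by split.
Qed.

(** * Arithmetic and the code of expressions and statements *)

Notation "p ;; q" := (PSeq p q) (at level 61, right associativity).

Definition copy x y : prog := POp (Op KTst x y 0).
Definition zero x : prog := POp (Op KSub x x x).
Definition inc x : prog := POp (Op KInc x x 0).
Definition add x y z : prog := POp (Op KAdd x y z).
Definition sub x y z : prog := POp (Op KSub x y z).
Definition dbl c x : prog := POp (Op (KDbl c) x x 0).
Definition ifnz x p q : prog := PIf (Op KTst x x 0) p q.
Definition ifodd_half x p q : prog := PIf (Op KHalf x x 0) p q.
Definition flip x : prog := ifnz x (zero x) (inc x).

Definition zval (s a : nat) : Z := if s == 0 then Z.of_nat a else (- Z.of_nat a)%Z.

(* A value is held by two registers, sign and magnitude; both [0] and [-0] are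
   allowed, and the sign register of a boolean is irrelevant. *)
Definition value_rep (v : value) (s a : nat) : Prop :=
  match v with VInt z => z = zval s a | VBool b => b = (a != 0) end.

(* Registers 3, 4 hold the first operand (and the result), 5, 6 the second one;
   7-12 are scratch. *)
Definition prog_add : prog :=
  let same := add 4 4 6 in
  let diff := PIf (Op KSub 7 4 6) (sub 4 6 4 ;; copy 3 5) (copy 4 7) in
  ifnz 3 (ifnz 5 same diff) (ifnz 5 diff same).

Definition prog_sub : prog := flip 5 ;; prog_add.

Definition rev_body : prog := ifodd_half 8 (dbl true 7) (dbl false 7).

(** A step of restoring division: the next bit of the dividend is shifted into the remainder in
    register 10, the divisor in register 6 is subtracted if possible, and the quotient bit enters
    register 8. *)
Definition div_body : prog :=
  ifodd_half 7 (dbl true 10) (dbl false 10) ;;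
  PIf (Op KSub 12 10 6) (dbl false 8) (copy 10 12 ;; dbl true 8).

(* Long division needs the dividend from its most significant bit on, so the
   first loop reverses it. *)
Definition prog_divmod : prog :=
  (zero 7 ;; copy 8 4 ;; copy 9 4) ;; PLoop 9 rev_body ;;
  (zero 8 ;; zero 10 ;; copy 11 4) ;; PLoop 11 div_body.

Definition unop_code (o : uop) : prog :=
  match o with
  | ONeg => flip 3
  | ONot => flip 4
  | OSize => zero 3 ;; copy 7 4 ;; zero 4 ;; PLoop 7 (inc 4)
  end.

(** An order comparison takes the magnitude of the difference as a boolean and clears it when the
    sign is the wrong one. A difference [-0] thus counts as zero. *)
Definition binop_code (o : bop) : prog :=
  match o with
  | OAdd => prog_add
  | OSub => prog_sub
  | ODiv => prog_divmod ;; ifnz 6 (copy 4 8 ;; ifnz 5 (flip 3) PSkip) (zero 4)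
  | OMod => prog_divmod ;; ifnz 6 (copy 4 10) (zero 4)
  | OGe => prog_sub ;; ifnz 3 PSkip (zero 4) ;; flip 4
  | OLt => prog_sub ;; ifnz 3 PSkip (zero 4)
  | OGt => prog_sub ;; ifnz 3 (zero 4) PSkip
  | OLe => prog_sub ;; ifnz 3 (zero 4) PSkip ;; flip 4
  | OEq => prog_sub ;; flip 4
  | ONe => prog_sub
  | OAnd => ifnz 4 (copy 4 6) PSkip
  | OOr => ifnz 4 PSkip (copy 4 6)
  end.

(** The exact length lets a loop of [nbits n] rounds be followed by induction on the list of
    bits. *)
Lemma val_bits_surj n : exists2 l, size l = nbits n & val_bits l = n.
Proof.
have [m] := ubnP n; elim: m n => // m IH n hn.
case: (posnP n) => [->|hpos].
  by exists [::] => //; apply/esym/eqP; rewrite -leqn0 nbits_le.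
have [|l hs hl] := IH n./2; first by lia.
exists (odd n :: l); first by rewrite nbits_gt0 -?lt0n //= hs.
by rewrite /= hl; lia.
Qed.

Lemma rev_loop l l0 R : R 8 = val_bits l -> R 7 = val_bits l0 ->
  loop (run rev_body) 9 (size l) R 7 = val_bits (catrev l l0).
Proof.
elim: l l0 R => [|b l IH] l0 R //= h8 h7.
apply: (IH (b :: l0));
  rewrite /rev_body /= /op_flag /op_run /set_reg /=; case: ifP => /= hb; case: b h8 hb => /=; lia.
Qed.

(** The invariant is that quotient times divisor plus remainder equals the part of the dividend read
    so far, evaluated by Horner's rule. *)
Lemma div_loop l R : R 7 = val_bits l -> R 10 < R 6 ->
  let R' := loop (run div_body) 11 (size l) R in
  R' 8 * R 6 + R' 10 = foldl (fun acc (b : bool) => b + acc.*2) (R 8 * R 6 + R 10) l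
  /\ R' 10 < R 6.
Proof.
elim: l R => [|b l IH] R //= h7 hlt.
set R1 := set_reg R 11 _; set R2 := run div_body R1.
have [h76 h77 h710 h78] : [/\ R2 6 = R 6, R2 7 = val_bits l, R2 10 < R2 6 &
    R2 8 * R2 6 + R2 10 = b + (R 8 * R 6 + R 10).*2].
  have e7 : odd (R 7) = b by lia.
  rewrite /R2 /div_body /= /op_flag /op_run /R1 /set_reg /= e7.
  by case: b {IH} h7 e7 => h7 e7 /=; case: ltnP => /=; split; rewrite ?mul1n ?add0n -?muln2 ?mulnDl; nia.
by have := IH R2 h77 h710; rewrite h78 h76.
Qed.

Lemma wf_binop_code o : wf (binop_code o).
Proof. by case: o. Qed.

Lemma prog_divmodP R : R 6 != 0 ->
  R 4 = run prog_divmod R 8 * R 6 + run prog_divmod R 10 /\ run prog_divmod R 10 < R 6.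
Proof.
move=> h6.
pose R1 := run (zero 7 ;; copy 8 4 ;; copy 9 4) R.
pose R2 := run (PLoop 9 rev_body) R1.
pose R3 := run (zero 8 ;; zero 10 ;; copy 11 4) R2.
have [l hs hl] := val_bits_surj (R 4).
have h2 : R2 7 = val_bits (rev l).
  have e8 : R1 8 = val_bits l by rewrite hl.
  have e7 : R1 7 = val_bits [::] by rewrite /R1 /= /op_run /set_reg /= subnn.
  by rewrite -(rev_loop e8 e7) hs.
have f2 r : r != 7 -> r != 8 -> r != 9 -> R2 r = R1 r.
  by move=> h7 h8 h9; rewrite /R2 frame //= (negbTE h7) (negbTE h8) (negbTE h9).
have h37 : R3 7 = val_bits (rev l) by rewrite -h2 /R3 frame.
(* The rounds are counted by a copy of the dividend: its low zeros become high zeros of the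
   reversal, whose bit length may be smaller. *)
have h311 : nbits (R3 11) = size (rev l).
  by rewrite size_rev hs /R3 /= /op_run /set_reg /= f2.
have h36 : R3 6 = R 6 by rewrite /R3 /= /op_run /set_reg /= f2.
have h310 : R3 10 = 0 by rewrite /R3 /= /op_run /set_reg /= subnn.
have h38 : R3 8 = 0 by rewrite /R3 /= /op_run /set_reg /= subnn.
have h6' : R3 10 < R3 6 by rewrite h36 h310 lt0n.
have [] := div_loop h37 h6'; rewrite -h311 -[loop _ _ _ _]/(run prog_divmod R).
by rewrite h36 h310 h38 foldl_rev => -> h.
Qed.

Lemma zsize_nbits z : zsize z = Z.of_nat (nbits (Z.abs_nat z)).
Proof.
have hpow k : Z.of_nat (2 ^ k) = (2 ^ Z.of_nat k)%Z.
  by elim: k => // k IH; rewrite expnS Nat2Z.inj_succ Z.pow_succ_r; lia.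
have h0 : (0 <= zsize z)%Z by exact: Z.log2_up_nonneg.
apply: Z.le_antisymm.
  apply/Z.log2_up_le_pow2; first by lia.
  by rewrite -hpow; have := nbits_le (Z.abs_nat z) (nbits (Z.abs_nat z)); rewrite leqnn; lia.
suff : nbits (Z.abs_nat z) <= Z.to_nat (zsize z) by lia.
rewrite nbits_le.
suff : (Z.abs z + 1 <= Z.of_nat (2 ^ Z.to_nat (zsize z)))%Z by lia.
by rewrite hpow Z2Nat.id //; apply/Z.log2_up_le_pow2; [lia | reflexivity].
Qed.

Lemma run_seq p q R : run (p ;; q) R = run q (run p R).
Proof. by []. Qed.

Lemma flipP x R : run (flip x) R x = (R x == 0).
Proof.
rewrite /flip /= /op_flag /= /op_run /set_reg /= !eqxx.
by case: (R x) => [|n] /=; rewrite !eqxx ?subnn.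
Qed.

Lemma flip_other x y R : y != x -> run (flip x) R y = R y.
Proof. by move=> h; rewrite frame //= (negbTE h). Qed.

Lemma prog_addP R :
  zval (run prog_add R 3) (run prog_add R 4) = (zval (R 3%N) (R 4%N) + zval (R 5%N) (R 6%N))%Z.
Proof.
rewrite /prog_add /= /op_flag /op_run /set_reg /zval /=.
case e3: (R 3 == 0); case e5: (R 5 == 0) => /=; try case: ltnP => h /=;
  by rewrite ?e3 ?e5; lia.
Qed.

Lemma prog_subP R :
  zval (run prog_sub R 3) (run prog_sub R 4) = (zval (R 3%N) (R 4%N) - zval (R 5%N) (R 6%N))%Z.
Proof.
rewrite /prog_sub run_seq prog_addP flipP !flip_other // /zval.
by case: (R 5 == 0) => /=; lia.
Qed.

(** Division truncates toward zero, so it acts on magnitudes; the quotient gets the product of the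
    signs and the remainder the sign of the dividend. *)
Lemma quot_rem_zval s t a b q r : b != 0 -> a = q * b + r -> r < b ->
  Z.quot (zval s a) (zval t b) = zval (if t == 0 then s else s == 0) q /\
  Z.rem (zval s a) (zval t b) = zval s r.
Proof.
move=> hb ha hr.
have hq : Z.quot (Z.of_nat a) (Z.of_nat b) = Z.of_nat q.
  by apply/esym/(@Z.quot_unique _ _ _ (Z.of_nat r)); lia.
have hm : Z.rem (Z.of_nat a) (Z.of_nat b) = Z.of_nat r.
  by apply/esym/(@Z.rem_unique _ _ (Z.of_nat q)); lia.
have hb' : Z.of_nat b <> 0%Z by lia.
have hb'' : (- Z.of_nat b)%Z <> 0%Z by lia.
rewrite /zval; case: s => [|s]; case: t => [|t] /=;
  by rewrite ?Z.rem_opp_r' ?Z.rem_opp_l' ?Z.quot_opp_l ?Z.quot_opp_r ?hq ?hm //; lia.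
Qed.

Lemma zval_neq0 (d : regs) : (d 4 != 0) = ~~ Z.eqb (zval (d 3) (d 4)) 0.
Proof. by rewrite /zval; case: (d 3) => [|n] /=; lia. Qed.

Lemma neg_tailP (d : regs) :
  (run (ifnz 3 PSkip (zero 4)) d 4 != 0) = Z.ltb (zval (d 3) (d 4)) 0.
Proof.
rewrite /= /op_flag /= /op_run /set_reg /= /zval.
by case: (d 3) => [|n] /=; rewrite ?subnn; lia.
Qed.

Lemma pos_tailP (d : regs) :
  (run (ifnz 3 (zero 4) PSkip) d 4 != 0) = Z.ltb 0 (zval (d 3) (d 4)).
Proof.
rewrite /= /op_flag /= /op_run /set_reg /= /zval.
by case: (d 3) => [|n] /=; rewrite ?subnn; lia.
Qed.

Lemma div_tailP (d : regs) :
  let R' := run (ifnz 6 (copy 4 8 ;; ifnz 5 (flip 3) PSkip) (zero 4)) d in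
  zval (R' 3) (R' 4) =
  if d 6 == 0 then 0%Z else zval (if d 5 == 0 then d 3 else d 3 == 0) (d 8).
Proof.
rewrite /= /op_flag /= /op_run /set_reg /= /zval; case: (d 6) => [|n] /=.
  by rewrite subnn; case: eqP.
by case: (d 5) => [|m] //=; case: (d 3) => [|x] //=; rewrite subnn.
Qed.

Lemma mod_tailP (d : regs) :
  let R' := run (ifnz 6 (copy 4 10) (zero 4)) d in
  zval (R' 3) (R' 4) = if d 6 == 0 then 0%Z else zval (d 3) (d 10).
Proof.
rewrite /= /op_flag /= /op_run /set_reg /= /zval; case: (d 6) => [|n] //=.
by rewrite subnn; case: eqP.
Qed.

Lemma binop_codeP o v1 v2 w R : eval_bop o v1 v2 = Some w ->
  value_rep v1 (R 3) (R 4) -> value_rep v2 (R 5) (R 6) ->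
  value_rep w (run (binop_code o) R 3) (run (binop_code o) R 4).
Proof.
have hs := prog_subP R; have hd := @prog_divmodP R.
have hf r : r \in [:: 3; 5; 6] -> run prog_divmod R r = R r.
  by rewrite !inE => /or3P[] /eqP->; apply: frame.
have hz : (zval (R 5%N) (R 6%N) =? 0)%Z = (R 6 == 0).
  by rewrite /zval; case: eqP => _; lia.
case: o; case: v1 => [a|a]; case: v2 => [b|b] h; try discriminate h; case: h => <-;
  rewrite /value_rep /binop_code => -> ->.
- by rewrite prog_addP.
- by rewrite prog_subP.
- rewrite run_seq div_tailP /zdiv0 hz (hf 3) // (hf 5) // (hf 6) //; case h: (R 6 == 0) => //; move/negbT in h; have [e1 e2] := hd h.
  by have [-> _] := quot_rem_zval (R 3) (R 5) h e1 e2.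
- rewrite run_seq mod_tailP /zmod0 hz (hf 3) // (hf 6) //; case h: (R 6 == 0) => //; move/negbT in h; have [e1 e2] := hd h.
  by have [_ ->] := quot_rem_zval (R 3) (R 5) h e1 e2.
- rewrite run_seq run_seq flipP; have := neg_tailP (run prog_sub R); rewrite hs.
  move: (run _ (run _ _) 4) => x.
  by case: x => [|x] /=; lia.
- rewrite run_seq run_seq flipP; have := pos_tailP (run prog_sub R); rewrite hs.
  move: (run _ (run _ _) 4) => x.
  by case: x => [|x] /=; lia.
- by rewrite run_seq pos_tailP hs; lia.
- by rewrite run_seq neg_tailP hs; lia.
- rewrite run_seq flipP; have := zval_neq0 (run prog_sub R); rewrite hs; move: (run prog_sub R 4) => x.
  by case: x => [|x] /=; lia.
- by rewrite zval_neq0 hs; lia.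
- by rewrite /= /op_flag /= /op_run /set_reg /=; case: (R 4) => [|x] //=; case: (R 6).
- by rewrite /= /op_flag /= /op_run /set_reg /=; case: (R 4) => [|x] //=; case: (R 6).
Qed.

Lemma inc_loop x y n R : x != y -> loop (run (inc x)) y n R x = R x + n.
Proof.
move=> h; elim: n R => [|n IH] R /=; first by rewrite addn0.
by rewrite IH /op_run /set_reg /= !eqxx (negbTE h) addSnnS.
Qed.

Lemma unop_codeP o v w R : eval_uop o v = Some w -> value_rep v (R 3) (R 4) ->
  value_rep w (run (unop_code o) R 3) (run (unop_code o) R 4).
Proof.
case: o; case: v => [a|a] h; try discriminate h; case: h => <-;
  rewrite /value_rep /unop_code => ->.
- by rewrite flipP flip_other // /zval; case: (R 3 == 0) => /=; lia.
- pose R1 := run (zero 3 ;; copy 7 4 ;; zero 4) R.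
  have e3 : run (zero 3 ;; copy 7 4 ;; zero 4 ;; PLoop 7 (inc 4)) R 3 = 0.
    by rewrite -[LHS]/(run (PLoop 7 (inc 4)) R1 3) frame // /R1 /= /op_run /set_reg /= subnn.
  have e4 : run (zero 3 ;; copy 7 4 ;; zero 4 ;; PLoop 7 (inc 4)) R 4 = nbits (R 4).
    rewrite -[LHS]/(loop (run (inc 4)) 7 (nbits (R 4)) R1 4) inc_loop //.
    by rewrite /R1 /= /op_run /set_reg /= subnn.
  by rewrite e3 e4 zsize_nbits /zval; case: (R 3 == 0) => /=; congr (Z.of_nat (nbits _)); lia.
- by rewrite flipP; case: (R 4).
Qed.

(* Registers 16 and above: sign and magnitude of each variable and of each
   temporary of nesting depth [d]. *)
Definition var_sg (x : var) : nat := 16 + 4 * x.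
Definition var_ab (x : var) : nat := 17 + 4 * x.
Definition tmp_sg (d : nat) : nat := 18 + 4 * d.
Definition tmp_ab (d : nat) : nat := 19 + 4 * d.

Definition store_rep (S : store) (R : regs) : Prop :=
  forall x v, S x = Some v -> value_rep v (R (var_sg x)) (R (var_ab x)).

Fixpoint expr_code (e : expr) (d : nat) : prog :=
  match e with
  | EVar x => copy 3 (var_sg x) ;; copy 4 (var_ab x)
  | ENat n => zero 3 ;; zero 4 ;; iter n (fun p => p ;; inc 4) PSkip
  | EBool b => zero 4 ;; (if b then inc 4 else PSkip)
  | EUn o e => expr_code e d ;; unop_code o
  | EBin o e1 e2 =>
      expr_code e1 d ;; (copy (tmp_sg d) 3 ;; copy (tmp_ab d) 4) ;; expr_code e2 d.+1 ;;
      (copy 5 3 ;; copy 6 4 ;; copy 3 (tmp_sg d) ;; copy 4 (tmp_ab d)) ;; binop_code o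
  | EParen e => expr_code e d
  end.

(* The loop bound is the bit length of the magnitude of [e], which is the number of
   times [PLoop] halves its register: register [tmp_ab d] is the loop register and
   register [tmp_sg d] counts the iterations. *)
Definition for_body (x : var) (d : nat) (p : prog) : prog :=
  (zero (var_sg x) ;; copy (var_ab x) (tmp_sg d) ;; inc (tmp_sg d)) ;; p.

Fixpoint stmt_code (s : stmt) (d : nat) : prog :=
  match s with
  | SDecl t x => zero (var_sg x) ;; zero (var_ab x)
  | SAssign x e => expr_code e d ;; copy (var_sg x) 3 ;; copy (var_ab x) 4
  | SBlock ss => foldr (fun s p => stmt_code s d ;; p) PSkip ss
  | SIf e s1 s2 => expr_code e d ;; ifnz 4 (stmt_code s1 d) (stmt_code s2 d)
  | SFor x e s =>
      expr_code e d ;; (copy (tmp_ab d) 4 ;; zero (tmp_sg d)) ;;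
      PLoop (tmp_ab d) (for_body x d (stmt_code s d.+1))
  end.

(** The generated principle gives no hypothesis for the statements inside a block; here they come as
    an iterated conjunction. *)
Lemma stmt_nested_ind (P : stmt -> Prop) :
  (forall t x, P (SDecl t x)) -> (forall x e, P (SAssign x e)) ->
  (forall ss, foldr (fun s Q => P s /\ Q) True ss -> P (SBlock ss)) ->
  (forall e s1 s2, P s1 -> P s2 -> P (SIf e s1 s2)) ->
  (forall x e s, P s -> P (SFor x e s)) ->
  forall s, P s.
Proof.
move=> hD hA hB hI hF; fix IH 1; case=> [t x|x e|ss|e s1 s2|x e s].
- exact: hD.
- exact: hA.
- by apply: hB; elim: ss => [|s ss IHs]; [exact: I | split; [exact: IH | exact: IHs]].
- by apply: hI; apply: IH.
- by apply: hF; apply: IH.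
Qed.

Lemma writes_unop_code o r : writes (unop_code o) r -> r < 16.
Proof. by case: o => /=; lia. Qed.

Lemma writes_binop_code o r : writes (binop_code o) r -> r < 16.
Proof. by case: o => /=; lia. Qed.

(** From 16 on, residues 0 and 1 modulo 4 are variables, 2 and 3 temporaries. Expression code thus
    preserves all variables and the temporaries of smaller depth. *)
Lemma writes_expr_code e d r : writes (expr_code e d) r -> (r < 16) || (tmp_sg d <= r) && (1 < r %% 4).
Proof.
elim: e d r => [x|n|b|o e IH|o e1 IH1 e2 IH2|e IH] d r; rewrite /tmp_sg //=.
- by lia.
- case/or3P; [by lia | by lia |].
  by elim: n => //= n IH /orP[/IH //|]; lia.
- by case: b => /=; lia.
- by case/orP => [/IH //|/writes_unop_code->].
- case/orP => [/IH1 //|]; rewrite /tmp_sg /tmp_ab; case/orP => [/orP[]/eqP->|]; rewrite ?orbT; try by lia.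
  case/orP => [/IH2|]; first by rewrite /tmp_sg; lia.
  by case/orP => [|/writes_binop_code->]; lia.
- exact: IH.
Qed.

(** The counters and loop registers of the enclosing loops, being temporaries of smaller depth,
    survive. *)
Lemma writes_stmt_code s d r : writes (stmt_code s d) r -> [|| r < 16, tmp_sg d <= r | r %% 4 < 2].
Proof.
have hce e d' : writes (expr_code e d') r -> [|| r < 16, tmp_sg d' <= r | r %% 4 < 2].
  by move/writes_expr_code; lia.
elim/stmt_nested_ind: s d => [t x|x e|ss IH|e s1 s2 IH1 IH2|x e s IH] d /=; rewrite /var_sg /var_ab.
- by lia.
- by case/orP => [/hce //|]; lia.
- elim: ss IH => //= s ss IHs [h1 h2] /orP[/h1 //|]; exact: IHs.
- by case/orP => [/hce //|/or3P[|/IH1 //|/IH2 //]]; lia.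
- case/orP => [/hce //|]; rewrite /tmp_sg /tmp_ab.
  case/orP => [|]; first by lia.
  case/orP => [|]; first by lia.
  case/orP => [|/IH]; rewrite /tmp_sg; lia.
Qed.

(** * Correctness of the code *)

Ltac regs :=
  rewrite /= /op_run /set_reg /=;
  repeat match goal with
  | |- context [if ?a == ?b then _ else _] =>
      first [ rewrite (_ : (a == b) = false); [| rewrite /var_sg /var_ab /tmp_sg /tmp_ab; lia]
            | rewrite (_ : (a == b) = true); [| rewrite /var_sg /var_ab /tmp_sg /tmp_ab; lia] ]
  end; rewrite ?subnn.

Lemma wf_expr_code e d : wf (expr_code e d).
Proof.
elim: e d => [x|n|b|o e IH|o e1 IH1 e2 IH2|e IH] d //=.
- by elim: n => //= n ->.
- by case: b.
- by rewrite IH; case: o.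
- by rewrite IH1 IH2 wf_binop_code.
Qed.

Lemma wf_stmt_code s d : wf (stmt_code s d).
Proof.
elim/stmt_nested_ind: s d => [t x|x e|ss IH|e s1 s2 IH1 IH2|x e s IH] d //=.
- by rewrite wf_expr_code.
- by elim: ss IH => //= s ss IHs [h1 h2]; rewrite h1 IHs.
- by rewrite wf_expr_code IH1 IH2.
- have h : writes (stmt_code s d.+1) (tmp_ab d) = false.
    by apply/negP => /writes_stmt_code; rewrite /tmp_sg /tmp_ab; lia.
  by rewrite wf_expr_code IH h /var_sg /var_ab /tmp_ab /tmp_sg; lia.
Qed.

Lemma rep_frame S p R : (forall x, ~~ writes p (var_sg x) /\ ~~ writes p (var_ab x)) ->
  store_rep S R -> store_rep S (run p R).
Proof. by move=> hw h x v /h; have [h1 h2] := hw x; rewrite !frame. Qed.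

Lemma rep_expr_code S e d R : store_rep S R -> store_rep S (run (expr_code e d) R).
Proof.
by apply: rep_frame => x; split; apply/negP => /writes_expr_code; rewrite /var_sg /var_ab /tmp_sg; lia.
Qed.

Lemma rep_set S p x v R : store_rep S R ->
  (forall y, y != x -> run p R (var_sg y) = R (var_sg y) /\ run p R (var_ab y) = R (var_ab y)) ->
  value_rep v (run p R (var_sg x)) (run p R (var_ab x)) -> store_rep (upd S x v) (run p R).
Proof.
move=> h hp hv y w; rewrite /upd; case: (eqVneq y x) => [-> [<-] //|/hp[-> ->]].
exact: h.
Qed.

Definition save d : prog := copy (tmp_sg d) 3 ;; copy (tmp_ab d) 4.
Definition restore d : prog := copy 5 3 ;; copy 6 4 ;; copy 3 (tmp_sg d) ;; copy 4 (tmp_ab d).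

Lemma restoreP d R : let R' := run (restore d) R in
  [/\ R' 3 = R (tmp_sg d), R' 4 = R (tmp_ab d), R' 5 = R 3 & R' 6 = R 4].
Proof. by split; regs. Qed.

Lemma rep_save S d R : store_rep S R -> store_rep S (run (save d) R).
Proof.
by apply: rep_frame => x; rewrite /= /var_sg /var_ab /tmp_sg /tmp_ab; lia.
Qed.

Lemma saved e d R : let R' := run (expr_code e d.+1) (run (save d) R) in
  R' (tmp_sg d) = R 3 /\ R' (tmp_ab d) = R 4.
Proof.
by split; rewrite frame; try (regs; done);
  apply/negP => /writes_expr_code; rewrite /tmp_sg /tmp_ab; lia.
Qed.

Lemma expr_codeP S e v d R : store_rep S R -> eval S e v ->
  value_rep v (run (expr_code e d) R 3) (run (expr_code e d) R 4).
Proof.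
elim: e v d R => [x|n|b|o e IH|o e1 IH1 e2 IH2|e IH] v d R hr he; inversion he; subst.
- by move: (hr x v); regs; apply.
- have h k R' : run (iter k (fun p => p ;; inc 4) PSkip) R' 4 = R' 4 + k.
    by elim: k => [|k IHk] //=; rewrite ?addn0 // [RHS]addnS -IHk.
  have h3 k R' : run (iter k (fun p => p ;; inc 4) PSkip) R' 3 = R' 3.
    by elim: k => [|k IHk] //=; rewrite -[RHS]IHk.
  rewrite [expr_code _ _]/= !run_seq h h3; regs.
  by rewrite /zval.
- by case: b {he}; regs.
- by rewrite [expr_code _ _]/= run_seq; apply: unop_codeP (IH _ _ _ hr _); eassumption.
- rewrite [expr_code _ _]/= 4!run_seq -/(save d) -/(restore d).
  set R1 := run (expr_code e1 d) R; set R3 := run (expr_code e2 d.+1) _.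
  have h1 := IH1 _ d _ hr H2.
  have h2 := IH2 _ d.+1 _ (rep_save d (rep_expr_code e1 d hr)) H4.
  have [s1 s2] : R3 (tmp_sg d) = R1 3 /\ R3 (tmp_ab d) = R1 4 := saved e2 d R1.
   have [r1 r2 r3 r4] := restoreP d R3.
  by apply: binop_codeP H5 _ _; rewrite ?r1 ?r2 ?r3 ?r4 ?s1 ?s2.
- exact: IH.
Qed.

Definition for_init d : prog := copy (tmp_ab d) 4 ;; zero (tmp_sg d).

Lemma rep_for_init S d R : store_rep S R -> store_rep S (run (for_init d) R).
Proof. by apply: rep_frame => x; rewrite /= /var_sg /var_ab /tmp_sg /tmp_ab; lia. Qed.

Definition for_head x d : prog := zero (var_sg x) ;; copy (var_ab x) (tmp_sg d) ;; inc (tmp_sg d).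

Lemma rep_for_head S x d R n : store_rep S R ->
  store_rep (upd S x (VInt (Z.of_nat (R (tmp_sg d))))) (run (for_head x d) (set_reg R (tmp_ab d) n)).
Proof.
move=> hr; have hr' : store_rep S (set_reg R (tmp_ab d) n).
  by move=> y v /hr; regs.
apply: rep_set => //.
  move=> y hy; have hy1 : var_sg y == var_sg x = false by rewrite /var_sg; lia.
  have hy2 : var_ab y == var_ab x = false by rewrite /var_ab; lia.
  by rewrite /= /op_run /set_reg /= hy1 hy2; split; regs.
by rewrite /value_rep (_ : run _ _ (var_sg x) = 0); [rewrite /zval /=; regs | regs].
Qed.

Lemma for_counter x s d R n :
  run (for_body x d (stmt_code s d.+1)) (set_reg R (tmp_ab d) n) (tmp_sg d) = (R (tmp_sg d)).+1.
Proof.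
rewrite /for_body run_seq frame; first by regs.
by apply/negP => /writes_stmt_code; rewrite /tmp_sg; lia.
Qed.

(** * Inversion of typing and execution, and the simulation of statements *)

Lemma decl_typeE G l t x G' : stmt_type G l (SDecl t x) G' ->
  [/\ G x = None, ~ (l = true /\ t = TIInt) & G' = upd G x t].
Proof. by move=> h; inversion h; subst. Qed.

Lemma assign_typeE G l x e G' : stmt_type G l (SAssign x e) G' ->
  exists tx, [/\ G x = Some tx, ~ (l = true /\ tx = TIInt) & G' = G].
Proof. by move=> h; inversion h; subst; exists tx. Qed.

Lemma block_typeE G l ss G' : stmt_type G l (SBlock ss) G' ->
  exists2 G1, seq_type G l ss G1 & G' = G.
Proof. by move=> h; inversion h; subst; exists G'0. Qed.

Lemma if_typeE G l e s1 s2 G' : stmt_type G l (SIf e s1 s2) G' ->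
  exists G1 G2, [/\ stmt_type G l s1 G1, stmt_type G l s2 G2 & G' = G].
Proof. by move=> h; inversion h; subst; exists G1, G2. Qed.

Lemma for_typeE G l x e s G' : stmt_type G l (SFor x e s) G' ->
  exists G1, [/\ has_type G l e TIInt, G x = None,
    stmt_type (upd G x TIInt) true s G1 & G' = G].
Proof.
move=> h; inversion h as [| | | |a b c d' f' G1 h1 h2 h3]; subst; exists G1.
by inversion h1; subst.
Qed.

Lemma seq_cons_typeE G l s ss G' : seq_type G l (s :: ss) G' ->
  exists2 G1, stmt_type G l s G1 & seq_type G1 l ss G'.
Proof. by move=> h; inversion h; subst; exists G1. Qed.

Lemma decl_execE S t x S' : exec S (SDecl t x) S' -> S' = upd S x (default_value t).
Proof. by move=> h; inversion h. Qed.

Lemma assign_execE S x e S' : exec S (SAssign x e) S' ->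
  exists2 v, eval S e v & S' = upd S x v.
Proof. by move=> h; inversion h; subst; exists v. Qed.

Lemma block_execE S ss S' : exec S (SBlock ss) S' -> exec_seq S ss S'.
Proof. by move=> h; inversion h. Qed.

Lemma if_execE S e s1 s2 S' : exec S (SIf e s1 s2) S' ->
  exists2 b, eval S e (VBool b) & exec S (if b then s1 else s2) S'.
Proof. by move=> h; inversion h; subst; [exists true | exists false]. Qed.

Lemma for_execE S x e s S' : exec S (SFor x e s) S' ->
  exists2 i, eval S (EUn OSize e) (VInt i) & exec_loop x s 0 i S S'.
Proof. by move=> h; inversion h; subst; exists i. Qed.

Lemma seq_nil_execE S S' : exec_seq S [::] S' -> S' = S.
Proof. by move=> h; inversion h. Qed.

Lemma seq_cons_execE S s ss S' : exec_seq S (s :: ss) S' ->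
  exists2 S1, exec S s S1 & exec_seq S1 ss S'.
Proof. by move=> h; inversion h; subst; exists S1. Qed.

Lemma exec_loop_inv x s j n S S' : exec_loop x s (Z.of_nat j) (Z.of_nat (j + n)) S S' ->
  match n with
  | 0 => S' = S
  | n'.+1 => exists2 S1, exec (upd S x (VInt (Z.of_nat j))) s S1 &
      exec_loop x s (Z.of_nat j.+1) (Z.of_nat (j.+1 + n')) S1 S'
  end.
Proof.
move=> h; inversion h; subst.
  by case: n h H => // n _; lia.
case: n h H H1 => [|n] h H H1; first by lia.
exists S1 => //; rewrite addSnnS.
by rewrite (_ : Z.of_nat j.+1 = Z.of_nat j + 1)%Z //; lia.
Qed.

Lemma for_loopP x s d :
  (forall S S' R, exec S s S' -> store_rep S R -> store_rep S' (run (stmt_code s d.+1) R)) ->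
  forall n j S S' R, exec_loop x s (Z.of_nat j) (Z.of_nat (j + n)) S S' ->
  store_rep S R -> R (tmp_sg d) = j ->
  store_rep S' (loop (run (for_body x d (stmt_code s d.+1))) (tmp_ab d) n R).
Proof.
move=> hs; elim=> [|n IH] j S S' R /exec_loop_inv; first by move->.
case=> S1 h1 h2 hr hj; apply: IH h2 _ _; last by rewrite for_counter hj.
by apply: hs h1 _; rewrite -hj; apply: rep_for_head.
Qed.

Lemma for_count e d S R i : store_rep S R -> eval S (EUn OSize e) (VInt i) ->
  i = Z.of_nat (nbits (run (expr_code e d) R 4)).
Proof.
move=> hr he; inversion he; subst.
have := expr_codeP d hr H1; move: H3; case: v H1 => // a _ [<-]; rewrite /value_rep => ->.
rewrite zsize_nbits /zval; case: eqP => _; congr (Z.of_nat (nbits _)); lia.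
Qed.

Lemma stmt_codeP s d S S' R : exec S s S' -> store_rep S R -> store_rep S' (run (stmt_code s d) R).
Proof.
elim/stmt_nested_ind: s d S S' R => [t x|x e|ss IH|e s1 s2 IH1 IH2|x e s IH] d S S' R he hr.
- rewrite (decl_execE he); apply: rep_set => //.
    move=> y hy; have hy1 : var_sg y == var_sg x = false by rewrite /var_sg; lia.
    have hy2 : var_ab y == var_ab x = false by rewrite /var_ab; lia.
    by rewrite /= /op_run /set_reg /= hy1 hy2; split; regs.
  by case: t {he} => /=; rewrite /value_rep /=; regs.
- have [v hv ->] := assign_execE he; have := expr_codeP d hr hv.
  rewrite [stmt_code _ _]/= run_seq => h; apply: rep_set; first exact: rep_expr_code.
    move=> y hy; have hy1 : var_sg y == var_sg x = false by rewrite /var_sg; lia.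
    have hy2 : var_ab y == var_ab x = false by rewrite /var_ab; lia.
    by rewrite /= /op_run /set_reg /= hy1 hy2; split; regs.
  by regs.
- move/block_execE: he; rewrite [stmt_code _ _]/= => {}he.
  elim: ss IH S R hr he => [|s ss IHs] IH S R hr; first by move/seq_nil_execE->.
  case: IH => h1 h2 /seq_cons_execE[S1 e1 e2].
  by rewrite [foldr _ _ _]/= run_seq; apply: IHs e2 => //; apply: h1 e1 hr.
- have [b hb hs] := if_execE he; have := expr_codeP d hr hb; rewrite [stmt_code _ _]/= run_seq.
  move: (run (expr_code e d) R) (rep_expr_code e d hr) => R1 hr1; rewrite /value_rep => hv.
  by rewrite /= op_run_tst /op_flag /= -hv; case: b hs {hb hv} => hs; [apply: IH1 hs _ | apply: IH2 hs _].
- have [i hi hl] := for_execE he; have hn := for_count d hr hi; subst i.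
  have hr1 := rep_for_init d (rep_expr_code e d hr).
  rewrite [stmt_code _ _]/= 2!run_seq -/(for_init d).
  set R1 := run (for_init d) _ in hr1 *.
  have e1 : R1 (tmp_ab d) = run (expr_code e d) R 4 by rewrite /R1; regs.
  have e2 : R1 (tmp_sg d) = 0 by rewrite /R1; regs.
  rewrite -[run _ _]/(loop (run (for_body x d (stmt_code s d.+1))) (tmp_ab d) (nbits (R1 (tmp_ab d))) R1).
  by apply: (@for_loopP x s d (IH d.+1) _ 0 S) => //; rewrite e1.
Qed.

(** * Polynomial bounds on expressions *)

(** Closure under composition makes bounds easy to assemble, and every member is monotone; an
    explicit bound is extracted only at the end, by [polynomial_le]. *)
Inductive polynomial : (nat -> nat) -> Prop :=
  | polynomial_const c : polynomial (fun _ => c)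
  | polynomial_id : polynomial (fun n => n)
  | polynomial_add f g : polynomial f -> polynomial g -> polynomial (fun n => f n + g n)
  | polynomial_mul f g : polynomial f -> polynomial g -> polynomial (fun n => f n * g n)
  | polynomial_comp f g : polynomial f -> polynomial g -> polynomial (fun n => f (g n)).

Lemma polynomial_mono f m n : polynomial f -> m <= n -> f m <= f n.
Proof.
move=> hf; elim: hf m n => [c|//|f1 g1 _ h1 _ h2|f1 g1 _ h1 _ h2|f1 g1 _ h1 _ h2] m n h //.
- by rewrite leq_add ?h1 ?h2.
- by rewrite leq_mul ?h1 ?h2.
- by rewrite h1 ?h2.
Qed.

Lemma polynomial_le f : polynomial f -> exists c k, forall n, f n <= c * n.+1 ^ k.
Proof.
elim=> [c||f1 g1 _ [c1 [k1 h1]] _ [c2 [k2 h2]]|f1 g1 _ [c1 [k1 h1]] _ [c2 [k2 h2]]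
       |f1 g1 _ [c1 [k1 h1]] _ [c2 [k2 h2]]].
- by exists c, 0 => n; rewrite expn0 muln1.
- by exists 1, 1 => n; rewrite expn1 mul1n.
- exists (c1 + c2), (k1 + k2) => n; rewrite mulnDl leq_add //.
    by apply: leq_trans (h1 n) _; rewrite leq_mul2l leq_pexp2l ?leq_addr ?orbT.
  by apply: leq_trans (h2 n) _; rewrite leq_mul2l leq_pexp2l ?leq_addl ?orbT.
- by exists (c1 * c2), (k1 + k2) => n; rewrite expnD mulnACA leq_mul.
(* This uses [(c2 * n.+1 ^ k2).+1 <= c2.+1 * n.+1 ^ k2]. *)
- exists (c1 * c2.+1 ^ k1), (k2 * k1) => n.
  apply: leq_trans (h1 _) _; rewrite -mulnA leq_mul2l expnM -expnMn.
  have hm a b e : a <= b -> a ^ e <= b ^ e by elim: e => // e IH hab; rewrite !expnS leq_mul ?IH.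
  by rewrite hm ?orbT // mulSn -add1n leq_add ?expn_gt0.
Qed.

Ltac poly :=
  match goal with
  | H : polynomial ?f |- polynomial ?f => exact H
  | |- polynomial (fun _ => ?c) => exact (polynomial_const c)
  | |- polynomial (fun n => n) => exact polynomial_id
  | |- polynomial (fun n => @?f n + @?g n) => apply (@polynomial_add f g); poly
  | |- polynomial (fun n => @?f n * @?g n) => apply (@polynomial_mul f g); poly
  | H : polynomial ?f |- polynomial (fun n => ?f (@?g n)) => apply (@polynomial_comp f g H); poly
  end.

Fixpoint loopfree (p : prog) : bool :=
  match p with
  | PSkip | POp _ => true
  | PSeq p q | PIf _ p q => loopfree p && loopfree q
  | PLoop _ _ => false
  end.

Lemma cost_loopfree p R : loopfree p -> cost p R <= code_size p.
Proof.
elim: p R => [|o|p IHp q IHq|o p IHp q IHq|y p IHp] R //= /andP[hp hq].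
- by rewrite leq_add ?IHp ?IHq.
- have := IHp (op_run o R) hp; have := IHq (op_run o R) hq; case: ifP => _; lia.
Qed.

Lemma cost_loopfree_loop p y R : loopfree p ->
  cost (PLoop y p) R <= nbits (R y) * (3 + code_size p) + 1.
Proof.
move=> hp /=; move: (nbits (R y)) => n; elim: n R => [//|n IH] R /=.
have := cost_loopfree (set_reg R y (R y)./2) hp; have := IH (run p (set_reg R y (R y)./2)).
by rewrite mulSn; lia.
Qed.

Lemma cost_seq p q R : cost (p ;; q) R = cost p R + cost q (run p R).
Proof. by []. Qed.

Lemma cost_unop_code o R B : (o = OSize -> nbits (R 4) <= B) -> cost (unop_code o) R <= 60 * B + 60.
Proof.
case: o => h; try by apply: leq_trans (cost_loopfree _ _) _ => //=; lia.
have {}h := h erefl; rewrite /unop_code !cost_seq.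
have e : nbits (R 4) = nbits (run (zero 4) (run (copy 7 4) (run (zero 3) R)) 7) by [].
move: (run (zero 4) _) e => R1 e.
by have := @cost_loopfree_loop (inc 4) 7 R1 isT; move: (cost (PLoop _ _) _) => c /=; lia.
Qed.

Lemma cost_divmod R : cost prog_divmod R <= 30 * nbits (R 4) + 20.
Proof.
rewrite /prog_divmod cost_seq; set p1 := (_ ;; _); set R1 := run p1 R.
rewrite cost_seq; set R2 := run (PLoop _ _) R1; rewrite cost_seq; set p2 := (_ ;; _ ;; _).
set R3 := run p2 R2.
have e3 : R3 11 = R 4 by rewrite -[LHS]/(R2 4) /R2 frame.
have h1 := @cost_loopfree p1 R isT; have h2 := @cost_loopfree p2 R2 isT.
have := @cost_loopfree_loop rev_body 9 R1 isT; have := @cost_loopfree_loop div_body 11 R3 isT.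
rewrite e3 (_ : R1 9 = R 4) //; move: (cost (PLoop _ _) _) (cost (PLoop _ _) _) h1 h2 => c1 c2.
by rewrite /=; lia.
Qed.

Lemma cost_binop_code o R B : (is_arith_op o -> nbits (R 4) <= B) -> cost (binop_code o) R <= 60 * B + 60.
Proof.
case: o => h; try by apply: leq_trans (cost_loopfree _ _) _ => //=; lia.
all: have {}h := h isT; rewrite /binop_code cost_seq; have := cost_divmod R; set p := ifnz _ _ _.
all: by have := @cost_loopfree p (run prog_divmod R) isT; rewrite [code_size _]/=; lia.
Qed.

Definition value_bnd (B : nat) (v : value) : Prop :=
  match v with VInt z => Z.abs_nat z < 2 ^ B | VBool _ => True end.

Definition store_bnd (B : nat) (S : store) : Prop := forall x v, S x = Some v -> value_bnd B v.

Definition iint_store_bnd (G : tenv) (A : nat) (S : store) : Prop :=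
  forall x v, G x = Some TIInt -> S x = Some v -> value_bnd A v.

Lemma vbnd_le A B v : A <= B -> value_bnd A v -> value_bnd B v.
Proof.
case: v => //= z h hz; apply: leq_trans hz _.
by rewrite leq_exp2l.
Qed.

(** A bound on the bits that evaluation can add: one per binary operator, and [n] for a literal [n],
    as [n < 2 ^ n]. *)
Fixpoint expr_size (e : expr) : nat :=
  match e with
  | EVar _ | EBool _ => 0
  | ENat n => n
  | EUn _ e | EParen e => expr_size e
  | EBin _ e1 e2 => (expr_size e1 + expr_size e2).+1
  end.

Fixpoint expr_vars (e : expr) : seq var :=
  match e with
  | EVar x => [:: x]
  | ENat _ | EBool _ => [::]
  | EUn _ e | EParen e => expr_vars e
  | EBin _ e1 e2 => expr_vars e1 ++ expr_vars e2
  end.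

Lemma nbits_leq n : nbits n <= n.
Proof. by rewrite nbits_le ltn_expl. Qed.

(** Only the variables that occur in [e] are bounded, so that the lemma serves both for [iint]
    expressions with the bound on [iint] variables and for arbitrary ones. *)
Lemma eval_bnd S B e v :
  (forall x w, x \in expr_vars e -> S x = Some w -> value_bnd B w) ->
  eval S e v -> value_bnd (B + expr_size e) v.
Proof.
elim: e v => [x|n|b|o e IH|o e1 IH1 e2 IH2|e IH] v hB he; inversion he; subst.
- by rewrite addn0; apply: hB H0; rewrite inE.
- by rewrite /= Zabs2Nat.id; apply: leq_trans (@ltn_expl 2 n isT) _; rewrite leq_exp2l ?leq_addl.
- by [].
- have := IH _ hB H1; move: H3; case: o {he hB} => [] ; case: v0 H1 => [z|b] _ h; try discriminate h; case: h => <- //= h'.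
  + by lia.
  + rewrite zsize_nbits Zabs2Nat.id; exact: leq_ltn_trans (nbits_leq _) h'.
- have h1 := IH1 _ (fun x w hx => hB x w (etrans (mem_cat _ _ _) (introT orP (or_introl hx)))) H2.
  have h2 := IH2 _ (fun x w hx => hB x w (etrans (mem_cat _ _ _) (introT orP (or_intror hx)))) H4.
  have := vbnd_le (leq_addr (expr_size e2) (B + expr_size e1)) h1.
  have := @vbnd_le (B + expr_size e2) (B + expr_size e1 + expr_size e2) _ ltac:(lia) h2.
  have := @vbnd_le _ (B + expr_size e1 + expr_size e2).+1 _ (leqnSn _); rewrite /=.
  rewrite addnS addnA; move: (B + expr_size e1 + expr_size e2) => N.
  move: H5; case: o {he hB}; case: v1 H2 h1 => [a|a] _ _; case: v2 H4 h2 => [b|b] _ _ h; try discriminate h; case: h => <- //= hm hb ha.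
  + by rewrite expnS; lia.
  + by rewrite expnS; lia.
  + apply: (hm (VInt _)); rewrite /= /zdiv0; case: Z.eqb_spec => hz; first by rewrite expn_gt0.
    apply: leq_ltn_trans ha; have := Z.quot_le_upper_bound (Z.abs a) (Z.abs b) (Z.abs a).
    by rewrite Z.quot_abs //; nia.
  + apply: (hm (VInt _)); rewrite /= /zmod0; case: Z.eqb_spec => hz; first by rewrite expn_gt0.
    apply: leq_ltn_trans ha; have := Z.rem_le (Z.abs a) (Z.abs b).
    by rewrite Z.rem_abs //; lia.
- exact: IH.
Qed.

(** The supremum of two integer types is [TIInt] only if both are, and no operator leads from
    booleans back to integers. *)
Lemma iint_evars G l e x : has_type G l e TIInt -> x \in expr_vars e -> G x = Some TIInt.
Proof.
elim: e => [y|n|b|o e IH|o e1 IH1 e2 IH2|e IH] h; inversion h; subst => //=.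
- by rewrite inE => /eqP->.
- exact: IH.
- exact: IH.
- rewrite mem_cat H2; clear H6 H7; case: t1 t2 H4 H5 H2 => [] [] // h1 h2 _.
  by case/orP; [apply: IH1 | apply: IH2].
- exact: IH.
Qed.

Lemma iint_bnd G l e S A v : has_type G l e TIInt -> iint_store_bnd G A S -> eval S e v ->
  value_bnd (A + expr_size e) v.
Proof. by move=> ht hA; apply: eval_bnd => x w /(iint_evars ht)/hA; apply. Qed.

Lemma sbnd_eval e S B v : store_bnd B S -> eval S e v -> value_bnd (B + expr_size e) v.
Proof. by move=> hB; apply: eval_bnd => x w _; apply: hB. Qed.

Lemma sbnd_le A B S : A <= B -> store_bnd A S -> store_bnd B S.
Proof. by move=> h hS x v /hS; apply: vbnd_le. Qed.

Lemma sbnd_upd B S x v : store_bnd B S -> value_bnd B v -> store_bnd B (upd S x v).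
Proof. by move=> hS hv y w; rewrite /upd; case: ifP => _; [case=> <- | move/hS]. Qed.

Lemma vrep_nbits B z s a : value_rep (VInt z) s a -> value_bnd B (VInt z) -> nbits a <= B.
Proof. by rewrite /= nbits_le => ->; rewrite /zval; case: eqP => _; lia. Qed.

Lemma expr_cost e d : exists2 f, polynomial f & forall S v R B,
  store_rep S R -> store_bnd B S -> eval S e v -> cost (expr_code e d) R <= f B.
Proof.
elim: e d => [x|n|b|o e IH|o e1 IH1 e2 IH2|e IH] d.
- by exists (fun _ => 2); first by poly.
- exists (fun _ => n.+2); first by poly.
  move=> S v R B _ _ _; rewrite [expr_code _ _]/= !cost_seq.
  have h R' : cost (iter n (fun p => p ;; inc 4) PSkip) R' = n.
    by elim: n => //= n ->; rewrite addn1.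
  by rewrite h.
- by exists (fun _ => 2); first (by poly); case: b.
- have [f nf hf] := IH d.
  exists (fun B => f B + (60 * (B + expr_size e) + 60)); first by poly.
  move=> S v R B hr hB he; inversion he; subst; rewrite [expr_code _ _]/= cost_seq leq_add //.
    exact: hf hr hB H1.
  apply: cost_unop_code => ho; subst o.
  have := sbnd_eval hB H1; have := expr_codeP d hr H1.
  by case: v0 H1 H3 => // z _ _; apply: vrep_nbits.
- have [f1 nf1 hf1] := IH1 d; have [f2 nf2 hf2] := IH2 d.+1.
  exists (fun B => f1 B + (2 + (f2 B + (4 + (60 * (B + expr_size e1) + 60))))); first by poly.
  move=> S v R B hr hB he; inversion he; subst.
  rewrite [expr_code _ _]/= 4!cost_seq -/(save d) -/(restore d).
  set R1 := run (expr_code e1 d) R; set R3 := run (expr_code e2 d.+1) _.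
  have hr2 := rep_save d (rep_expr_code e1 d hr).
  rewrite leq_add ?(hf1 _ _ _ _ hr hB H2) // leq_add // leq_add ?(hf2 _ _ _ _ hr2 hB H4) //.
  rewrite leq_add //; apply: cost_binop_code => ho.
  have [_ s2] : R3 (tmp_sg d) = R1 3 /\ R3 (tmp_ab d) = R1 4 := saved e2 d R1.
  have [_ r2 _ _] := restoreP d R3; rewrite r2 s2.
  have := sbnd_eval hB H2; have := expr_codeP d hr H2.
  case: v1 H2 H5 => [z|b] _ h; first by apply: vrep_nbits.
  by case: o ho h {he}.
- by have [f nf hf] := IH d; exists f => // S v R B hr hB he; inversion he; subst; apply: hf hB _; eassumption.
Qed.

(** * Polynomial bounds on statements *)

Lemma stmt_type_ext G l s G' x t : stmt_type G l s G' -> G x = Some t -> G' x = Some t.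
Proof.
case: s => [t' y|y e|ss|e s1 s2|y e s].
- by move=> /decl_typeE[h _ ->] hx; rewrite /upd; case: eqP => // e; rewrite -e hx in h.
- by case/assign_typeE => tx [_ _ ->].
- by case/block_typeE => G1 _ ->.
- by case/if_typeE => G1 [G2 [_ _ ->]].
- by case/for_typeE => G1 [_ _ _ ->].
Qed.

(** No [iint] variable can be declared inside a loop, so a bound on those of [G] covers those of
    [G']. *)
Lemma stmt_type_iint G s G' x :
  stmt_type G true s G' -> G' x = Some TIInt -> G x = Some TIInt.
Proof.
case: s => [t' y|y e|ss|e s1 s2|y e s].
- by case/decl_typeE => _ h ->; rewrite /upd; case: eqP => // _ [e]; case: h.
- by case/assign_typeE => tx [_ _ ->].
- by case/block_typeE => G1 _ ->.
- by case/if_typeE => G1 [G2 [_ _ ->]].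
- by case/for_typeE => G1 [_ _ _ ->].
Qed.

Lemma exec_loop_preserves (P : store -> Prop) x s :
  (forall S S' j, exec (upd S x (VInt j)) s S' -> P S -> P S') ->
  forall j i S S', exec_loop x s j i S S' -> P S -> P S'.
Proof.
move=> hP j i S S' h.
elim: h hP => // x' s' j' i' S0 S1 S2 _ he _ IH hP hS.
by apply: IH => //; apply: hP he hS.
Qed.

(** Inside a loop assignments to [iint] variables are forbidden, and declared variables and loop
    counters must be fresh. *)
Lemma exec_iint s G G' S S' x : stmt_type G true s G' -> exec S s S' ->
  G x = Some TIInt -> S' x = S x.
Proof.
elim/stmt_nested_ind: s G G' S S' => [t y|y e|ss IH|e s1 s2 IH1 IH2|y e s IH] G G' S S' ht he hx.
- have [h _ _] := decl_typeE ht; rewrite (decl_execE he) /upd; case: eqP => // e.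
  by rewrite -e hx in h.
- have [tx [h1 h2 _]] := assign_typeE ht; have [v _ ->] := assign_execE he.
  by rewrite /upd; case: eqP => // e'; subst; case: h2; move: hx; rewrite h1 => -[->].
- have [G1 {}ht _] := block_typeE ht; move/block_execE: he => {}he.
  elim: ss IH G S hx ht he => [|s ss IHs] IH G S hx; first by move=> _ /seq_nil_execE->.
  case: IH => h1 h2 /seq_cons_typeE[G2 t1 t2] /seq_cons_execE[S1 e1 e2].
  by rewrite (IHs h2 _ _ (stmt_type_ext t1 hx) t2 e2) (h1 _ _ _ _ t1 e1 hx).
- have [G1 [G2 [t1 t2 _]]] := if_typeE ht; have [b _] := if_execE he.
  by case: b => hs; [apply: IH1 t1 hs hx | apply: IH2 t2 hs hx].
- have [G1 [_ hy t1 _]] := for_typeE ht; have [i _ hl] := for_execE he.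
  have hxy : (x == y) = false by apply/eqP => e'; subst; rewrite hx in hy.
  have hP S1 S2 j : exec (upd S1 y (VInt j)) s S2 -> S1 x = S x -> S2 x = S x.
    by move=> h <-; rewrite (IH _ _ _ _ t1 h) /upd hxy.
  exact: (exec_loop_preserves hP hl).
Qed.

Lemma sbnd_int B S x j : store_bnd B S -> j < B -> store_bnd B (upd S x (VInt (Z.of_nat j))).
Proof.
move=> hB hj; apply: sbnd_upd => //=; rewrite Zabs2Nat.id.
by apply: ltn_trans hj _; apply: ltn_expl.
Qed.

Lemma size_execE S e i : eval S (EUn OSize e) (VInt i) -> exists z, eval S e (VInt z).
Proof. by move=> h; inversion h; subst; case: v H1 H3 => // z h1 _; exists z. Qed.

Lemma cost_for_body x s d R n :
  cost (for_body x d (stmt_code s d.+1)) (set_reg R (tmp_ab d) n) =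
  3 + cost (stmt_code s d.+1) (run (for_head x d) (set_reg R (tmp_ab d) n)).
Proof. by []. Qed.

Lemma loop_costS p c y n R : loop_cost p c y n.+1 R =
  3 + c (set_reg R y (R y)./2) + loop_cost p c y n (p (set_reg R y (R y)./2)).
Proof. by []. Qed.

Section ForLoop.
Variables (x : var) (s : stmt) (d : nat) (g f : nat -> nat).
Hypotheses (ng : polynomial g) (nf : polynomial f).
Hypothesis body : forall G G' S S' R A B, stmt_type G true s G' -> exec S s S' ->
  store_rep S R -> iint_store_bnd G A S -> store_bnd B S ->
  store_bnd (B + g A) S' /\ cost (stmt_code s d.+1) R <= f (A + B).

Lemma for_iter_cost G G' A n j S S' R B :
  G x = None -> stmt_type (upd G x TIInt) true s G' ->
  exec_loop x s (Z.of_nat j) (Z.of_nat (j + n)) S S' -> store_rep S R -> R (tmp_sg d) = j ->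
  j + n <= A -> A <= B -> iint_store_bnd G A S -> store_bnd B S ->
  store_bnd (B + n * g A) S' /\
  loop_cost (run (for_body x d (stmt_code s d.+1))) (cost (for_body x d (stmt_code s d.+1))) (tmp_ab d) n R
    <= 1 + n * (6 + f (A + (B + n * g A))).
Proof.
move=> hx ht; elim: n j S R B => [|n IH] j S R B hl hr hj hn hAB hA hB.
  by rewrite (exec_loop_inv hl) addn0.
have [S1 h1 h2] := exec_loop_inv hl.
pose R0 := run (for_head x d) (set_reg R (tmp_ab d) (R (tmp_ab d))./2).
have hr0 : store_rep (upd S x (VInt (Z.of_nat j))) R0 by rewrite -hj; apply: rep_for_head.
have hA0 : iint_store_bnd (upd G x TIInt) A (upd S x (VInt (Z.of_nat j))).
  move=> y v; rewrite /upd; case: eqP => _; last exact: hA.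
  move=> _ [<-] /=; rewrite Zabs2Nat.id; apply: ltn_trans (@ltn_expl 2 A isT).
  lia.
have hB0 : store_bnd B (upd S x (VInt (Z.of_nat j))) by apply: sbnd_int => //; lia.
have [hB1 hc] := body ht h1 hr0 hA0 hB0.
have hA1 : iint_store_bnd G A S1.
  move=> y v hy; have hxy : (y == x) = false by apply/eqP => e; rewrite e hx in hy.
  rewrite (exec_iint (x := y) ht h1); first by rewrite /upd hxy; apply: hA.
  by rewrite /upd hxy.
have hr1 := stmt_codeP d.+1 h1 hr0.
have [||hB2 hc2] := IH _ _ _ _ h2 hr1 (etrans (for_counter x s d R _) (congr1 succn hj)) _ _ hA1 hB1; try lia.
split; first by apply: sbnd_le hB2; rewrite mulSn; lia.
rewrite loop_costS cost_for_body -/R0.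
have e : A + (B + g A + n * g A) = A + (B + n.+1 * g A) by rewrite mulSn; lia.
have : f (A + B) <= f (A + (B + n.+1 * g A)) by apply: polynomial_mono => //; lia.
rewrite e in hc2; move: (f (A + (B + _))) hc2 => F hc2 hF.
by rewrite -[run (for_body _ _ _) _]/(run (stmt_code s d.+1) R0) mulSn; lia.
Qed.

(** The indicator [l] is arbitrary, so nested and outermost loops are both covered. The bound being
    [iint], there are at most [A + expr_size e] rounds. *)
Lemma for_cost e : exists g' f', [/\ polynomial g', polynomial f' &
  forall G l G' S S' R A B, has_type G l e TIInt -> G x = None ->
  stmt_type (upd G x TIInt) true s G' -> exec S (SFor x e s) S' ->
  store_rep S R -> iint_store_bnd G A S -> store_bnd B S ->
  store_bnd (B + g' A) S' /\ cost (stmt_code (SFor x e s) d) R <= f' (A + B)].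
Proof.
have [fe nfe hfe] := expr_cost e d.
pose k := expr_size e.
exists (fun A => (A + k) + (A + k) * g (A + k)).
exists (fun n => fe n + (2 + (1 + (n + k) *
   (6 + f ((n + k) + ((n + k) + (n + k) * g (n + k))))))).
split; [by poly | by poly |].
move=> G l G' S S' R A B hte hx ht he hr hA hB.
have [i hi hl] := for_execE he; have hn := for_count d hr hi; subst i.
have hr1 := rep_for_init d (rep_expr_code e d hr).
have [z hv] : exists z, eval S e (VInt z) := size_execE hi.
set N := nbits _ in hl.
have hN : N <= A + k.
  exact: vrep_nbits (expr_codeP d hr hv) (iint_bnd hte hA hv).
rewrite [stmt_code _ _]/= !cost_seq -/(for_init d).
set R1 := run (for_init d) _ in hr1 *.
have e1 : R1 (tmp_ab d) = run (expr_code e d) R 4 by rewrite /R1; regs.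
have e2 : R1 (tmp_sg d) = 0 by rewrite /R1; regs.
(* Both bounds are raised so that the first exceeds the number of rounds and the second the
   first. *)
have hA' : iint_store_bnd G (A + k) S by move=> y w h1 h2; apply: vbnd_le (hA _ _ h1 h2); lia.
have hB' : store_bnd (B + (A + k)) S by apply: sbnd_le hB; lia.
have [||hB2 hc2] := for_iter_cost hx ht (j := 0) (n := N) hl hr1 e2 _ _ hA' hB'; try lia.
split.
  apply: sbnd_le hB2; rewrite -addnA leq_add2l leq_add2l leq_mul2r; lia.
rewrite leq_add //; first by apply: leq_trans (hfe _ _ _ _ hr hB hv) _; apply: polynomial_mono => //; lia.
rewrite -[cost (PLoop _ _) _]/(loop_cost (run (for_body x d (stmt_code s d.+1)))
   (cost (for_body x d (stmt_code s d.+1))) (tmp_ab d) (nbits (R1 (tmp_ab d))) R1) e1 -/N.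
have [hAn hBn] : A + k <= A + B + k /\ B + (A + k) <= A + B + k by lia.
have hg : g (A + k) <= g (A + B + k) by apply: polynomial_mono.
have hNg : N * g (A + k) <= (A + B + k) * g (A + B + k) by apply: leq_mul => //; lia.
rewrite leq_add2l; apply: leq_trans hc2 _; rewrite leq_add2l; apply: leq_mul; first by lia.
by rewrite leq_add2l; apply: polynomial_mono => //; lia.
Qed.
End ForLoop.

(* Inside a loop the variables of type [iint] keep the size bound [A], so the iteration
   counts depend on [A] alone, and all sizes grow additively. *)
Lemma loop_stmt_cost s d : exists g f, [/\ polynomial g, polynomial f &
  forall G G' S S' R A B, stmt_type G true s G' -> exec S s S' ->
  store_rep S R -> iint_store_bnd G A S -> store_bnd B S ->
  store_bnd (B + g A) S' /\ cost (stmt_code s d) R <= f (A + B)].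
Proof.
elim/stmt_nested_ind: s d => [t x|x e|ss IH|e s1 s2 IH1 IH2|x e s IH] d.
- exists (fun _ => 0), (fun _ => 2); split; [by poly | by poly |].
  move=> G G' S S' R A B _ he _ _ hB; rewrite (decl_execE he) addn0; split=> //.
  by apply: sbnd_upd => //; case: t {he} => //=; rewrite expn_gt0.
- have [f nf hf] := expr_cost e d.
  exists (fun _ => expr_size e), (fun n => f n + 2); split; [by poly | by poly |].
  move=> G G' S S' R A B _ he hr _ hB; have [v hv ->] := assign_execE he; split.
    by apply: sbnd_upd; [apply: sbnd_le hB; lia | apply: sbnd_eval hv].
  rewrite [stmt_code _ _]/= cost_seq leq_add //; apply: leq_trans (hf _ _ _ _ hr hB hv) _.
  by apply: polynomial_mono => //; lia.
- suff [g [f [ng nf h]]] : exists g f, [/\ polynomial g, polynomial f &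
      forall G G' S S' R A B, seq_type G true ss G' -> exec_seq S ss S' ->
      store_rep S R -> iint_store_bnd G A S -> store_bnd B S ->
      store_bnd (B + g A) S' /\ cost (stmt_code (SBlock ss) d) R <= f (A + B)].
    exists g, f; split=> // G G' S S' R A B /block_typeE[G1 ht _] /block_execE he.
    exact: h ht he.
  elim: ss IH => [_|s ss IHs [/(_ d)[g1 [f1 [ng1 nf1 h1]]] /IHs[g2 [f2 [ng2 nf2 h2]]]]].
    exists (fun _ => 0), (fun _ => 0); split; [by poly | by poly |].
    by move=> G G' S S' R A B _ /seq_nil_execE->; rewrite addn0.
  exists (fun n => g1 n + g2 n), (fun n => f1 n + f2 (n + g1 n)); split; [by poly | by poly |].
  move=> G G' S S' R A B /seq_cons_typeE[G1 t1 t2] /seq_cons_execE[S1 e1 e2] hr hA hB.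
  have [hB1 hc1] := h1 _ _ _ _ _ _ _ t1 e1 hr hA hB.
  have hA1 : iint_store_bnd G1 A S1.
    move=> x v /(stmt_type_iint t1) hx; rewrite (exec_iint t1 e1 hx); exact: hA.
  have [hB2 hc2] := h2 _ _ _ _ _ _ _ t2 e2 (stmt_codeP d e1 hr) hA1 hB1.
  rewrite addnA; split=> //.
  rewrite [stmt_code _ _]/= cost_seq leq_add //; apply: leq_trans hc2 _; apply: polynomial_mono => //.
  have : g1 A <= g1 (A + B) by apply: polynomial_mono => //; lia.
  lia.
- have [f nf hf] := expr_cost e d.
  have [g1 [f1 [ng1 nf1 h1]]] := IH1 d; have [g2 [f2 [ng2 nf2 h2]]] := IH2 d.
  exists (fun n => g1 n + g2 n), (fun n => f n + (2 + (f1 n + f2 n))).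
  split; [by poly | by poly |].
  move=> G G' S S' R A B /if_typeE[G1 [G2 [t1 t2 _]]] /if_execE[b hb hs] hr hA hB.
  have hv := expr_codeP d hr hb; have hr1 := rep_expr_code e d hr; have hc := hf _ _ _ _ hr hB hb.
  have hf' : f B <= f (A + B) by apply: polynomial_mono => //; lia.
  rewrite [stmt_code _ _]/= cost_seq; set R1 := run (expr_code e d) R in hv hr1 *.
  have -> : cost (ifnz 4 (stmt_code s1 d) (stmt_code s2 d)) R1 =
     (if b then 2 + cost (stmt_code s1 d) R1 else 1 + cost (stmt_code s2 d) R1).
    by rewrite /= op_run_tst /op_flag /= -hv.
  case: b hs {hb hv} => hs.
    have [hB1 hc1] := h1 _ _ _ _ _ _ _ t1 hs hr1 hA hB.
    by split; [apply: sbnd_le hB1 |]; lia.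
  have [hB1 hc1] := h2 _ _ _ _ _ _ _ t2 hs hr1 hA hB.
  by split; [apply: sbnd_le hB1 |]; lia.
- have [g [f [ng nf h]]] := IH d.+1.
  have [g' [f' [ng' nf' h']]] := for_cost x ng nf h e.
  exists g', f'; split=> // G G' S S' R A B /for_typeE[G1 [hte hx ht _]] he hr hA hB.
  exact: h' hte hx ht he hr hA hB.
Qed.

(* Outside loops [iint] variables may be assigned values of any size; the bounds compose,
   but only a fixed number of times. *)
Lemma top_stmt_cost s d : exists2 f, polynomial f &
  forall G G' S S' R B, stmt_type G false s G' -> exec S s S' -> store_rep S R -> store_bnd B S ->
  store_bnd (f B) S' /\ cost (stmt_code s d) R <= f B.
Proof.
elim/stmt_nested_ind: s d => [t x|x e|ss IH|e s1 s2 IH1 IH2|x e s IH] d.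
- exists (fun n => n + 2); first by poly.
  move=> G G' S S' R B _ he _ hB; rewrite (decl_execE he); split; last by rewrite leq_addl.
  apply: sbnd_upd; first by apply: sbnd_le hB; lia.
  by case: t {he} => //=; rewrite expn_gt0.
- have [f nf hf] := expr_cost e d.
  exists (fun n => f n + 2 + (n + expr_size e)); first by poly.
  move=> G G' S S' R B _ he hr hB; have [v hv ->] := assign_execE he; split.
    apply: sbnd_upd; first by apply: sbnd_le hB; lia.
    by apply: vbnd_le (sbnd_eval hB hv); lia.
  by rewrite [stmt_code _ _]/= cost_seq; have := hf _ _ _ _ hr hB hv; rewrite [cost (_ ;; _) _]/=; lia.
- suff [f nf h] : exists2 f, polynomial f &
      forall G G' S S' R B, seq_type G false ss G' -> exec_seq S ss S' ->
      store_rep S R -> store_bnd B S -> store_bnd (f B) S' /\ cost (stmt_code (SBlock ss) d) R <= f B.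
    exists f => // G G' S S' R B /block_typeE[G1 ht _] /block_execE he.
    exact: h ht he.
  elim: ss IH => [_|s ss IHs [/(_ d)[f1 nf1 h1] /IHs[f2 nf2 h2]]].
    exists (fun n => n); first by poly.
    by move=> G G' S S' R B _ /seq_nil_execE->.
  exists (fun n => f1 n + f2 (f1 n)); first by poly.
  move=> G G' S S' R B /seq_cons_typeE[G1 t1 t2] /seq_cons_execE[S1 e1 e2] hr hB.
  have [hB1 hc1] := h1 _ _ _ _ _ _ t1 e1 hr hB.
  have [hB2 hc2] := h2 _ _ _ _ _ _ t2 e2 (stmt_codeP d e1 hr) hB1.
  split; first by apply: sbnd_le hB2; lia.
  by rewrite [stmt_code _ _]/= cost_seq leq_add.
- have [f nf hf] := expr_cost e d.
  have [f1 nf1 h1] := IH1 d; have [f2 nf2 h2] := IH2 d.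
  exists (fun n => f n + (2 + (f1 n + f2 n))); first by poly.
  move=> G G' S S' R B /if_typeE[G1 [G2 [t1 t2 _]]] /if_execE[b hb hs] hr hB.
  have hv := expr_codeP d hr hb; have hr1 := rep_expr_code e d hr; have hc := hf _ _ _ _ hr hB hb.
  rewrite [stmt_code _ _]/= cost_seq; set R1 := run (expr_code e d) R in hv hr1 *.
  have -> : cost (ifnz 4 (stmt_code s1 d) (stmt_code s2 d)) R1 =
     (if b then 2 + cost (stmt_code s1 d) R1 else 1 + cost (stmt_code s2 d) R1).
    by rewrite /= op_run_tst /op_flag /= -hv.
  case: b hs {hb hv} => hs.
    have [hB1 hc1] := h1 _ _ _ _ _ _ t1 hs hr1 hB.
    by split; [apply: sbnd_le hB1 |]; lia.
  have [hB1 hc1] := h2 _ _ _ _ _ _ t2 hs hr1 hB.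
  by split; [apply: sbnd_le hB1 |]; lia.
- have [g [f [ng nf h]]] := loop_stmt_cost s d.+1.
  have [g' [f' [ng' nf' h']]] := for_cost x ng nf h e.
  (* On entry to an outermost loop one bound serves for the [iint] variables and for the whole
     store, whence [n + n]. *)
  exists (fun n => n + g' n + f' (n + n)); first by poly.
  move=> G G' S S' R B /for_typeE[G1 [hte hx ht _]] he hr hB.
  have hA : iint_store_bnd G B S by move=> y v _; apply: hB.
  have [hB1 hc] := h' _ _ _ _ _ _ _ _ hte hx ht he hr hA hB.
  by split; [apply: sbnd_le hB1 |]; lia.
Qed.

(** * Input, output and the theorem *)

Definition holds_input (w : seq isym) (R : regs) : Prop := forall r, r < 3 -> R r = inregs w r.

Lemma holds_input_set w R x v : 2 < x -> holds_input w R -> holds_input w (set_reg R x v).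
Proof. by move=> hx h r hr; rewrite /set_reg ifF ?h //; lia. Qed.

(** Track 0 is set for every symbol, so a loop on a copy of register 0 runs once per remaining
    symbol. *)
Lemma nbits_inregs w : nbits (inregs w 0) = size w.
Proof.
rewrite /inregs; elim: w => [|a w IH] /=.
  by apply/eqP; rewrite -leqn0 nbits_le.
rewrite nbits_gt0; last by lia.
by rewrite -IH; congr (nbits _).+1; lia.
Qed.

Definition half x : prog := POp (Op KHalf x x 0).

Definition read_sym (d : nat) : prog :=
  half 0 ;;
  ifodd_half 1 (ifodd_half 2 (inc 14) (dbl true (tmp_ab d)))
               (ifodd_half 2 (inc (tmp_sg d)) (dbl false (tmp_ab d))).

Definition read_body (d : nat) : prog :=
  ifnz 0 (ifnz 14 PSkip (read_sym d)) PSkip.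

(* Register 14 is set once the separator has been read; from then on the loop,
   which is run as often as there are symbols left, idles. *)
Definition read_arg (d : nat) : prog :=
  (copy 13 0 ;; zero 14 ;; zero (tmp_sg d) ;; zero (tmp_ab d)) ;; PLoop 13 (read_body d).

(** Variables are set after the recursive call, so the leftmost of repeated parameters prevails, as
    in [init_store]. *)
Fixpoint read_args (xs : seq var) (d : nat) : prog :=
  match xs with
  | [::] => PSkip
  | x :: xs => read_arg d ;; read_args xs d.+1 ;; copy (var_sg x) (tmp_sg d) ;; copy (var_ab x) (tmp_ab d)
  end.

Definition digit (sa : nat * nat) (a : isym) : nat * nat :=
  match a with
  | I0 => (sa.1, sa.2.*2)
  | I1 => (sa.1, sa.2.*2.+1)
  | IMinus => (sa.1.+1, sa.2)
  | ISep => sa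
  end.

Lemma read_body_idle d R : R 0 == 0 \/ R 14 != 0 -> run (read_body d) R = R.
Proof.
move=> h; rewrite /read_body /= !op_run_tst /op_flag /=.
by case: eqP h => //= _ [//|->].
Qed.

Definition is_sep (a : isym) : nat := if a is ISep then 1 else 0.

Lemma read_symP d a w R : holds_input (a :: w) R -> R 14 = 0 ->
  let R' := run (read_body d) R in
  [/\ holds_input w R', R' 14 = is_sep a &
      (R' (tmp_sg d), R' (tmp_ab d)) = digit (R (tmp_sg d), R (tmp_ab d)) a].
Proof.
move=> h h14; have e0 := h 0 isT; have e1 := h 1 isT; have e2 := h 2 isT.
have -> : run (read_body d) R = run (read_sym d) R.
  by rewrite /read_body [LHS]/= !op_run_tst /op_flag /= h14 e0 /=; case: ifP.
rewrite /inregs /= in e0 e1 e2.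
have -> : run (read_sym d) R =
  let R1 := set_reg (set_reg (set_reg R 0 (R 0)./2) 1 (R 1)./2) 2 (R 2)./2 in
  match a with
  | I0 => run (dbl false (tmp_ab d)) R1
  | I1 => run (dbl true (tmp_ab d)) R1
  | IMinus => run (inc (tmp_sg d)) R1
  | ISep => run (inc 14) R1
  end.
  rewrite /read_sym /= /op_flag /op_run /= /set_reg /= e1 e2.
  by case: a {h e0 e1 e2} => /=; rewrite ?oddD ?odd_double.
have hr3 (r : nat) : r < 3 -> r = 0 \/ r = 1 \/ r = 2 by lia.
case: a h e0 e1 e2 => h e0 e1 e2; split; try by regs.
all: try by move=> r /hr3[->|[->|->]]; regs; rewrite ?e0 ?e1 ?e2 /inregs; lia.
by regs; rewrite h14.
Qed.

Lemma loopD p y m n R : loop p y (m + n) R = loop p y n (loop p y m R).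
Proof. by elim: m R => //= m IH R. Qed.

Lemma loopS p y n R : loop p y n.+1 R = loop p y n (p (set_reg R y (R y)./2)).
Proof. by []. Qed.

Lemma read_idle_loop d n R r : R 0 == 0 \/ R 14 != 0 -> r != 13 ->
  loop (run (read_body d)) 13 n R r = R r.
Proof.
move=> + hr; elim: n R => [//|n IH] R h.
by rewrite loopS read_body_idle // IH // /set_reg (negbTE hr).
Qed.

Lemma read_digits d u v R : all (fun a => is_sep a == 0) u -> holds_input (u ++ v) R -> R 14 = 0 ->
  let R' := loop (run (read_body d)) 13 (size u) R in
  [/\ holds_input v R', R' 14 = 0 &
      (R' (tmp_sg d), R' (tmp_ab d)) = foldl digit (R (tmp_sg d), R (tmp_ab d)) u].
Proof.
elim: u R => [|a u IH] R //; rewrite [all _ _]/= => /andP[/eqP ha hu] h h14.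
have hi : holds_input (a :: u ++ v) (set_reg R 13 (R 13)./2) by apply: holds_input_set.
have h14' : set_reg R 13 (R 13)./2 14 = 0 by [].
have [h1 h2 h3] := read_symP d hi h14'; rewrite ha in h2.
have [g1 g2 g3] := IH _ hu h1 h2; split=> //.
by rewrite g3 h3; regs.
Qed.

Lemma foldl_digit_pos s p : foldl digit (s, 0) (pos_bits p) = (s, Pos.to_nat p).
Proof. by elim: p => //= p IH; rewrite foldl_rcons IH /digit /=; congr pair; lia. Qed.

Lemma pos_bits_nosep p : all (fun a => is_sep a == 0) (pos_bits p).
Proof. by elim: p => //= p IH; rewrite all_rcons. Qed.

Lemma enc_Z_nosep z : all (fun a => is_sep a == 0) (enc_Z z).
Proof. by case: z => //= p; apply: pos_bits_nosep. Qed.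

Lemma foldl_digit_enc z :
  let sa := foldl digit (0, 0) (enc_Z z) in zval sa.1 sa.2 = z.
Proof. by case: z => [|p|p] //; rewrite [enc_Z _]/= ?[foldl _ _ _]/= foldl_digit_pos /zval /=; lia. Qed.

Definition at_sep (w : seq isym) : bool := if w is a :: _ then is_sep a == 1 else true.

Lemma read_argP d z w R :
  holds_input (enc_Z z ++ w) R -> at_sep w ->
  let R' := run (read_arg d) R in
  holds_input (behead w) R' /\ zval (R' (tmp_sg d)) (R' (tmp_ab d)) = z.
Proof.
move=> h hw.
set R1 := run (copy 13 0 ;; zero 14 ;; zero (tmp_sg d) ;; zero (tmp_ab d)) R.
have h1 : holds_input (enc_Z z ++ w) R1.
  by move=> r hr; rewrite -h // /R1; regs.
have e13 : nbits (R1 13) = size (enc_Z z) + size w.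
  by rewrite -size_cat -nbits_inregs -h // /R1; regs.
have e14 : R1 14 = 0 by rewrite /R1; regs.
have ets : R1 (tmp_sg d) = 0 by rewrite /R1; regs.
have eta : R1 (tmp_ab d) = 0 by rewrite /R1; regs.
have -> : run (read_arg d) R = loop (run (read_body d)) 13 (nbits (R1 13)) R1 by [].
(* The rounds split into those reading the number, one for the separator if there is one, and idle
   ones. *)
rewrite e13 loopD.
have [] := read_digits d (enc_Z_nosep z) h1 e14; rewrite ets eta.
move: (loop _ _ _ R1) => R2 h2 h14 hd.
have hz : zval (R2 (tmp_sg d)) (R2 (tmp_ab d)) = z.
  by rewrite -[RHS]foldl_digit_enc -hd.
case: w {h h1 e13} h2 hw => [|a w] h2 hw; first by split.
rewrite [size _]/= loopS [behead _]/=.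
have hi : holds_input (a :: w) (set_reg R2 13 (R2 13)./2) by apply: holds_input_set.
have h14' : set_reg R2 13 (R2 13)./2 14 = 0 by [].
have [g1 g2 g3] := read_symP d hi h14'; rewrite (eqP hw) in g2.
have g4 : run (read_body d) (set_reg R2 13 (R2 13)./2) 0 == 0 \/
          run (read_body d) (set_reg R2 13 (R2 13)./2) 14 != 0 by right; rewrite g2.
move: (run (read_body d) (set_reg R2 13 (R2 13)./2)) g1 g2 g3 g4 => X g1 g2 g3 g4.
split.
  by move=> r hr; rewrite read_idle_loop //; [apply: g1 | lia].
rewrite !read_idle_loop //; try by rewrite /tmp_sg /tmp_ab; lia.
case: a hw g3 {h2 hi} => // _ [-> ->].
by move: hz; regs.
Qed.

Lemma writes_read_arg d r : writes (read_arg d) r -> [|| r < 16, r == tmp_sg d | r == tmp_ab d].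
Proof. by rewrite /= /tmp_sg /tmp_ab; lia. Qed.

Lemma writes_read_args xs d r : writes (read_args xs d) r -> [|| r < 16, tmp_sg d <= r | r %% 4 < 2].
Proof.
elim: xs d => //= x xs IH d /orP[|/orP[/IH|]].
- by move/writes_read_arg; rewrite /tmp_sg /tmp_ab; lia.
- by rewrite /tmp_sg; lia.
- by rewrite /var_sg /var_ab; lia.
Qed.

Lemma wf_read_args xs d : wf (read_args xs d).
Proof. by elim: xs d => //= x xs IH d; rewrite IH /tmp_sg /tmp_ab; lia. Qed.

Lemma enc_tuple_cons z zs : exists w, [/\ enc_tuple (z :: zs) = enc_Z z ++ w,
  at_sep w & behead w = enc_tuple zs].
Proof.
case: zs => [|y ys]; first by exists [::]; rewrite cats0.
by exists (ISep :: enc_tuple (y :: ys)).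
Qed.

Lemma read_argsP xs zs d R : size zs = size xs -> holds_input (enc_tuple zs) R ->
  store_rep (init_store xs zs) (run (read_args xs d) R).
Proof.
elim: xs zs d R => [|x xs IH] [|z zs] d R // [hs] h.
have [w [e1 e2 e3]] := enc_tuple_cons z zs.
have e1' : holds_input (enc_Z z ++ w) R by rewrite -e1.
have [h1 hz] := read_argP d e1' e2.
rewrite [read_args _ _]/= 2!run_seq [init_store _ _]/=.
move: (run (read_arg d) R) h1 hz => R1; rewrite e3 => /(IH _ d.+1 _ hs) hr hz.
have f1 : run (read_args xs d.+1) R1 (tmp_sg d) = R1 (tmp_sg d).
  by apply: frame; apply/negP => /writes_read_args; rewrite /tmp_sg; lia.
have f2 : run (read_args xs d.+1) R1 (tmp_ab d) = R1 (tmp_ab d).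
  by apply: frame; apply/negP => /writes_read_args; rewrite /tmp_sg /tmp_ab; lia.
apply: rep_set => //.
  move=> y hy; have hy1 : var_sg y == var_sg x = false by rewrite /var_sg; lia.
  have hy2 : var_ab y == var_ab x = false by rewrite /var_ab; lia.
  by rewrite /= /op_run /set_reg /= hy1 hy2; split; regs.
by rewrite /value_rep; regs; rewrite f1 f2.
Qed.

Lemma cost_read_arg d w R n : holds_input w R -> n = size w -> cost (read_arg d) R <= 40 * n + 30.
Proof.
move=> h ->; rewrite /read_arg cost_seq; set R1 := run _ R.
have -> : size w = nbits (R1 13) by rewrite -nbits_inregs -h // /R1; regs.
have := @cost_loopfree_loop (read_body d) 13 R1 isT.
by move: (cost (PLoop _ _) _) => c; rewrite /=; lia.
Qed.

Lemma cost_read_args xs zs d R : size zs = size xs -> holds_input (enc_tuple zs) R ->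
  cost (read_args xs d) R <= size xs * (40 * size (enc_tuple zs) + 40).
Proof.
elim: xs zs d R => [|x xs IH] [|z zs] d R // [hs] h.
have [w [e1 e2 e3]] := enc_tuple_cons z zs.
have e1' : holds_input (enc_Z z ++ w) R by rewrite -e1.
have [h1 _] := read_argP d e1' e2; rewrite e3 in h1.
have := IH _ d.+1 _ hs h1.
have hsz : size (enc_tuple zs) <= size (enc_tuple (z :: zs)).
  by rewrite e1 size_cat -e3 size_behead; lia.
move: (size (enc_tuple (z :: zs))) hsz (congr1 size e1) => n hsz hn.
have : size xs * (40 * size (enc_tuple zs) + 40) <= size xs * (40 * n + 40).
  by rewrite leq_mul2l; lia.
have : cost (read_arg d) R <= 40 * n + 30.
  exact: cost_read_arg e1' hn.
rewrite [read_args _ _]/= !cost_seq mulSn.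
move: (cost (read_arg d) R) (cost (read_args xs d.+1) _) => c1 c2; rewrite /=; lia.
Qed.

Definition push (a : isym) : prog :=
  dbl (symbit 0 a) 0 ;; dbl (symbit 1 a) 1 ;; dbl (symbit 2 a) 2.

Lemma pushP a w R : holds_input w R -> holds_input (a :: w) (run (push a) R).
Proof.
move=> h; have e0 := h 0 isT; have e1 := h 1 isT; have e2 := h 2 isT.
by move=> [|[|[|r]]] // _; rewrite /push; regs; rewrite ?e0 ?e1 ?e2.
Qed.

Lemma run_ifnzT x p q R : R x != 0 -> run (ifnz x p q) R = run p R.
Proof. by rewrite /= !op_run_tst /op_flag /= => ->. Qed.

Lemma run_ifnzF x p q R : R x = 0 -> run (ifnz x p q) R = run q R.
Proof. by rewrite /= !op_run_tst /op_flag /= => ->. Qed.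

Definition out_body : prog := ifodd_half 4 (push I1) (push I0).

(** Zero of either sign becomes the single digit [I0]; otherwise the sign is pushed last, in front
    of the digits. *)
Definition output : prog :=
  (zero 0 ;; zero 1 ;; zero 2) ;;
  ifnz 4 ((copy 7 4 ;; PLoop 7 out_body) ;; ifnz 3 (push IMinus) PSkip) (push I0).

(** Bits leave register 4 least significant first and each is prepended, which yields the order of
    [pos_bits]. *)
Lemma out_loop p w R : R 4 = Pos.to_nat p -> holds_input w R ->
  holds_input (pos_bits p ++ w) (loop (run out_body) 7 (nbits (Pos.to_nat p)) R).
Proof.
have hb R' : run out_body R' =
  run (push (if odd (R' 4) then I1 else I0)) (set_reg R' 4 (R' 4)./2).
  by rewrite /out_body [LHS]/= /op_flag /=; case: ifP.
have hp a R' : run (push a) R' 4 = R' 4 by case: a.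
elim: p w R => [p IH|p IH|] w R h4 hw.
- have e : (Pos.to_nat p~1)./2 = Pos.to_nat p by lia.
  rewrite nbits_gt0 ?e; last by lia.
  rewrite loopS cat_rcons; apply: IH; rewrite hb.
    by rewrite hp /set_reg /= h4.
  rewrite (_ : odd _ = true); last by rewrite /set_reg /= h4; lia.
  by apply: pushP; do 2 apply: holds_input_set => //.
- have e : (Pos.to_nat p~0)./2 = Pos.to_nat p by lia.
  rewrite nbits_gt0 ?e; last by lia.
  rewrite loopS cat_rcons; apply: IH; rewrite hb.
    by rewrite hp /set_reg /= h4.
  rewrite (_ : odd _ = false); last by rewrite /set_reg /= h4; lia.
  by apply: pushP; do 2 apply: holds_input_set => //.
- rewrite nbits_gt0 // (_ : nbits _ = 0) // loopS hb.
  rewrite (_ : odd _ = true); last by rewrite /set_reg /= h4.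
  by apply: pushP; do 2 apply: holds_input_set => //.
Qed.

Lemma outputP R z : z = zval (R 3) (R 4) -> holds_input (enc_Z z) (run output R).
Proof.
pose R1 := run (zero 0 ;; zero 1 ;; zero 2) R.
have h1 : holds_input [::] R1 by move=> [|[|[|r]]] // _; rewrite /R1; regs.
have -> : run output R =
  run (ifnz 4 ((copy 7 4 ;; PLoop 7 out_body) ;; ifnz 3 (push IMinus) PSkip) (push I0)) R1 by [].
rewrite -[R 3]/(R1 3) -[R 4]/(R1 4); move: R1 h1 => R1 h1.
case: (posnP (R1 4)) => h4 ->.
  by rewrite run_ifnzF // /zval h4 if_same; apply: pushP.
rewrite run_ifnzT ?run_seq -?lt0n //; set R2 := run (copy 7 4) R1.
have [p hp] : exists p, R1 4 = Pos.to_nat p by exists (Pos.of_nat (R1 4)); lia.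
have h2 : holds_input [::] R2 by move=> r hr; rewrite -h1 // /R2; regs.
have e7 : R2 7 = R2 4 by rewrite /R2; regs.
have := out_loop (w := [::]) (p := p) (R := R2) hp h2.
have e3 : loop (run out_body) 7 (nbits (Pos.to_nat p)) R2 3 = R1 3.
  by rewrite -hp -[R1 4]/(R2 4) -e7 -[LHS]/(run (PLoop 7 out_body) R2 3) frame.
have -> : run (PLoop 7 out_body) R2 = loop (run out_body) 7 (nbits (Pos.to_nat p)) R2.
  by rewrite -hp -[R1 4]/(R2 4) -e7.
rewrite cats0 -e3; move: (loop _ _ _ R2) => R3; rewrite /zval hp; case: eqP => h3 hw.
  by rewrite run_ifnzF // (_ : Z.of_nat _ = Z.pos p) //; lia.
have h3' : R3 3 != 0 by apply/eqP.
rewrite (run_ifnzT _ _ h3') (_ : (- Z.of_nat _)%Z = Z.neg p); last by lia.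
exact: pushP hw.
Qed.

Lemma cost_output R : cost output R <= 40 * nbits (R 4) + 40.
Proof.
rewrite /output cost_seq; set R1 := run _ R; have -> : R 4 = R1 4 by rewrite /R1; regs.
have h1 : cost (zero 0 ;; zero 1 ;; zero 2) R = 3 by [].
have h2 : cost (push I0) R1 <= 3 by [].
have h3 p q : cost (ifnz 4 p q) R1 <= 2 + cost p R1 + cost q R1.
  by rewrite /= op_run_tst; case: ifP; lia.
apply: leq_trans (leq_add (eq_leq h1) (h3 _ _)) _; rewrite !cost_seq.
set R2 := run (copy 7 4) R1; have e7 : R2 7 = R1 4 by rewrite /R2; regs.
have := @cost_loopfree_loop out_body 7 R2 isT; rewrite e7.
have := @cost_loopfree (ifnz 3 (push IMinus) PSkip) (run (PLoop 7 out_body) R2) isT.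
move: (cost (PLoop _ _) _) (cost (ifnz _ _ _) _) h2 => c1 c2.
move: (cost (push I0) _) => c3; rewrite /=; lia.
Qed.

Definition program_code (p : program) : prog :=
  read_args (prog_params p) 0 ;; stmt_code (SBlock (prog_body p)) 0 ;; expr_code (prog_ret p) 0 ;; output.

Lemma wf_program_code p : wf (program_code p).
Proof.
have wfS q1 q2 : wf (q1 ;; q2) = wf q1 && wf q2 by [].
by rewrite /program_code 3!wfS wf_read_args wf_stmt_code wf_expr_code.
Qed.

Lemma pos_bits_bnd p : Pos.to_nat p < 2 ^ size (pos_bits p).
Proof. by elim: p => //= p IH; rewrite size_rcons expnS; lia. Qed.

Lemma enc_Z_bnd z : Z.abs_nat z < 2 ^ size (enc_Z z).
Proof. by case: z => //= p; have := pos_bits_bnd p; rewrite ?expnS; lia. Qed.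

Lemma sbnd_init xs zs : store_bnd (size (enc_tuple zs)) (init_store xs zs).
Proof.
elim: xs zs => [|x xs IH] [|z zs] //.
have [w [e1 _ e3]] := enc_tuple_cons z zs.
apply: sbnd_upd.
  by apply: sbnd_le (IH zs); rewrite e1 size_cat -e3 size_behead; lia.
by apply: (vbnd_le (A := size (enc_Z z))); [rewrite e1 size_cat leq_addr | apply: enc_Z_bnd].
Qed.

Lemma program_codeP p : well_typed p -> exists2 F, polynomial F &
  forall zs r, size zs = size (prog_params p) -> prog_outputs p zs r ->
  holds_input (enc_Z r) (run (program_code p) (inregs (enc_tuple zs))) /\
  cost (program_code p) (inregs (enc_tuple zs)) <= F (size (enc_tuple zs)).
Proof.
case=> G [t [hs _]].
have [f nf hf] := top_stmt_cost (SBlock (prog_body p)) 0.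
have [fe nfe hfe] := expr_cost (prog_ret p) 0.
exists (fun n => size (prog_params p) * (40 * n + 40) +
  (f n + (fe (f n) + (40 * (f n + expr_size (prog_ret p)) + 40)))); first by poly.
move=> zs r hz [S' [he hr]]; set n := size (enc_tuple zs).
have hi : holds_input (enc_tuple zs) (inregs (enc_tuple zs)) by [].
have h0 := read_argsP 0 hz hi; have c0 := cost_read_args 0 hz hi.
have ht : stmt_type (init_tenv (prog_params p)) false (SBlock (prog_body p))
  (init_tenv (prog_params p)) by apply: tys_block hs.
have he' : exec (init_store (prog_params p) zs) (SBlock (prog_body p)) S' by apply: ex_block.
have [hB c1] := hf _ _ _ _ _ _ ht he' h0 (@sbnd_init _ zs).
have h1 := stmt_codeP 0 he' h0; have c2 := hfe _ _ _ _ h1 hB hr.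
have h2 := expr_codeP 0 h1 hr; have hn := vrep_nbits h2 (sbnd_eval hB hr).
rewrite /program_code 3!run_seq; split; first exact: outputP.
rewrite !cost_seq; apply: leq_add => //; apply: leq_add => //; apply: leq_add => //.
by apply: leq_trans (cost_output _) _; rewrite leq_add2r leq_mul2l.
Qed.

Theorem theorem3 (m : nat) (f : seq Z -> Z) : FPC m f -> FP m f.
Proof.
case=> p [hm [hw hp]].
have [F nF hF] := program_codeP hw.
have [M hM] := machine_of_prog (wf_program_code p).
(* This is the time bound of [machine_of_prog] with the cost replaced by [F n]. *)
have nT : polynomial (fun n => F n * ((n + F n) * 2 + 3) + (n + F n + 1)) by poly.
have [c [k hck]] := polynomial_le nT.
exists M, c, k => zs hz; have hz' : size zs = size (prog_params p) by rewrite hm.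
have [h1 h2] := hF zs _ hz' (hp zs hz).
apply: hM => //; apply: leq_trans (hck _); rewrite -muln2 -addn1.
by apply: leq_add; [apply: leq_mul => //; lia | lia].
Qed.
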